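(* Let $S_7=\{(3,-1,-1,-2),(4,-1,0,-3),(4,0,0,-6),(4,1,0,-9)\}$. If $(t_1,t_2,t_3,t_4)\in S_7$, then for all integers $n\geq 0$, $$a_{1^{t_1}2^{t_2}3^{t_3}4^{t_4}}(2n)>0,\qquad a_{1^{t_1}2^{t_2}3^{t_3}4^{t_4}}(4n+1)<0,\qquad a_{1^{t_1}2^{t_2}3^{t_3}4^{t_4}}(4n+3)>0.$$
   Context: For $|q|<1$ (or as formal power series in $q$) let $f_j:=(q^j;q^j)_\infty=\prod_{k\ge 1}(1-q^{jk})$ for each positive integer $j$. For a positive integer $m$ and integers $t_1,\dots,t_m$ (possibly zero or negative), the integers $a_{1^{t_1}2^{t_2}\cdots m^{t_m}}(n)$, $n\ge 0$, are defined by $\sum_{n=0}^\infty a_{1^{t_1}2^{t_2}\cdots m^{t_m}}(n)q^n=f_1^{t_1}f_2^{t_2}\cdots f_m^{t_m}$. *)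

(* Defs.v *)
From mathcomp Require Import all_boot all_order all_algebra.
Set Implicit Arguments.
Unset Strict Implicit.
Unset Printing Implicit Defensive.
Import Order.TTheory GRing.Theory Num.Theory.
Local Open Scope ring_scope.

(* A formal power series is given by its sequence of coefficients;
   two series are equal when they agree pointwise (=1). *)
Definition fps := nat -> int.

Definition fps1 : fps := fun n => (n == 0)%:R.

Definition fps_mul (u v : fps) : fps :=
  fun n => \sum_(i < n.+1) u i * v (n - i)%N.

Definition fps_exp (u : fps) (k : nat) : fps := iter k (fps_mul u) fps1.

(* The first n coefficients of 1 / u, from the recurrence
   u 0 * v n = [n = 0] - \sum_(i < n) u (n - i) * v i.
   This is the inverse only if u 0 is a unit, see fps_mulrV. *)
Fixpoint fps_inv_seq (u : fps) (n : nat) : seq int :=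
  if n is m.+1 then
    let s := fps_inv_seq u m in
    rcons s ((u 0%N)^-1 * ((m == 0)%:R - \sum_(i < m) u (m - i)%N * s`_i))
  else [::].

Definition fps_inv (u : fps) : fps := fun n => (fps_inv_seq u n.+1)`_n.

Definition fps_expz (u : fps) (z : int) : fps :=
  match z with
  | Posz k => fps_exp u k
  | Negz k => fps_exp (fps_inv u) k.+1
  end.

Definition euler_partial (j N : nat) : {poly int} :=
  \prod_(1 <= k < N.+1) (1 - 'X^(j * k)).

(* f_j = \prod_(k >= 1) (1 - q^(j k)). For j > 0 the factors with k > n do not
   affect the coefficient of q^n, see euler_fE. *)
Definition euler_f (j : nat) : fps := fun n => (euler_partial j n)`_n.

(* For t = [:: t_1; ...; t_m], the series f_1^(t_1) f_2^(t_2) ... f_m^(t_m). *)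
Definition eta_quotient (t : seq int) : fps :=
  \big[fps_mul/fps1]_(i < size t) fps_expz (euler_f i.+1) t`_i.

Definition S7 : seq (int * int * int * int) :=
  [:: (3, -1, -1, -2); (4, -1, 0, -3); (4, 0, 0, -6); (4, 1, 0, -9)].

Lemma size_fps_inv_seq u n : size (fps_inv_seq u n) = n.
Proof. by elim: n => //= n IHn; rewrite size_rcons IHn. Qed.

Lemma nth_fps_inv_seq u n i :
  (i < n)%N -> (fps_inv_seq u n)`_i = fps_inv u i.
Proof.
elim: n => // n IHn; rewrite ltnS leq_eqVlt => /predU1P[-> //|lt_in].
by rewrite /= nth_rcons size_fps_inv_seq lt_in IHn.
Qed.

Lemma fps_mulrV u : u 0%N \is a GRing.unit -> fps_mul u (fps_inv u) =1 fps1.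
Proof.
move=> u0 n; rewrite /fps_mul big_ord_recl /= subn0 {1}/fps_inv /=.
rewrite nth_rcons size_fps_inv_seq ltnn eqxx mulVKr //.
rewrite -addrA addrC -[RHS]add0r; congr (_ + _); apply/eqP.
rewrite addrC subr_eq0 (reindex_inj rev_ord_inj) /=; apply/eqP.
apply: eq_bigr => i _; rewrite nth_fps_inv_seq //.
by rewrite /bump leq0n add1n subnSK // subKn // ltnW.
Qed.

Lemma euler_fE j N n : (0 < j)%N -> (n <= N)%N ->
  (euler_partial j N)`_n = euler_f j n.
Proof.
move=> j0; elim: N => [|N IHN]; first by rewrite leqn0 => /eqP->.
rewrite leq_eqVlt => /predU1P[-> //|]; rewrite ltnS => le_nN.
rewrite /euler_partial big_nat_recr //= mulrBr mulr1 coefB coefMXn.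
have -> : (n < j * N.+1)%N by rewrite (leq_trans _ (leq_pmull _ j0)).
by rewrite subr0 IHN.
Qed.

Lemma euler_f0 j : euler_f j 0 = 1.
Proof. by rewrite /euler_f /euler_partial big_geq // coef1. Qed.

(* Main.v *)
(* Each of the four quotients A has a 2-dissection A(q) = U(q^2) - c q V(q^2)
   with c = 3 or 4 in which U(q) and V(-q) are infinite products whose
   coefficients are visibly positive. The dissections come from
     f_1^4   = f_4^10 / (f_2^2 f_8^4) - 4 q f_2^2 f_8^4 / f_4^2,
     f_1^3 / f_3 = f_4^3 / f_12 - 3 q f_2^2 f_12^3 / (f_4 f_6^2).
   Both are consequences of one bilinear identity between the theta series
     T_{D,r}(c) = \sum_{n in Z} c^n q^(D n (n - 1) / 2 + r n),
   namely (for 2 r <= D)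
     T_{D,r}(c) T_{D,r}(d) = T_{2D,2r}(c d) T_{2D,D}(c / d)
                             + c q^r T_{2D,D+2r}(c d) T_{2D,0}(d / c),
   which follows by splitting the double sum over (m, n) according to the
   parity of m + n; the Jacobi triple product turns every T into an eta
   quotient. The first dissection is the case D = 2, r = 1, c = d = -1. The
   second one combines D = 3, r = 1, c = d = -1 with D = 1, r = 0, c = -w,
   d = -1/w, where w is a primitive cube root of unity.
   The only positivity that is not factorwise obvious is that of
   f_3^2 / (f_1 f_6), the product of the
   (1 - q^(6k+3)) / ((1 - q^(3k+1)) (1 - q^(3k+2))), where
   (1 - x y) / ((1 - x) (1 - y)) = 1 / (1 - y) + x / (1 - x), and that of
   f_2^5 / (f_1 f_4)^2, which is the theta series T_{2,1}(1). *)

Require Import Defs.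
From HB Require Import structures.
From mathcomp Require Import all_boot all_order all_algebra all_field.
From mathcomp Require Import boolp.
From mathcomp Require Import zify ring.
Set Implicit Arguments.
Unset Strict Implicit.
Unset Printing Implicit Defensive.
Import Order.TTheory GRing.Theory Num.Theory.
Local Open Scope ring_scope.

(** * The ring of formal power series over a commutative ring *)

Definition series (R : Type) := nat -> R.

(** Equality of coefficient sequences is decided classically, and [funext] turns pointwise equality
    into equality; this lets sequences form a ring on which [ring] works. *)
HB.instance Definition _ R := gen_eqMixin (series R).
HB.instance Definition _ R := gen_choiceMixin (series R).

Section SeriesRing.
Variable R : comNzRingType.
Implicit Types u v w : series R.

Definition szero : series R := fun=> 0.
Definition sopp u : series R := fun n => - u n.
Definition sadd u v : series R := fun n => u n + v n.
Definition sone : series R := fun n => (n == 0)%:R.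
Definition smul u v : series R := fun n => \sum_(i < n.+1) u i * v (n - i)%N.

Definition strunc n u : {poly R} := \poly_(i < n) u i.

(** Degree n of a product sees only the coefficients up to n, so polynomials can replace the series.
    Associativity and commutativity are thereby inherited from [{poly R}]. *)
Lemma smulE n u v (p p' : {poly R}) :
  (forall i, (i <= n)%N -> p`_i = u i) -> (forall i, (i <= n)%N -> p'`_i = v i) ->
  smul u v n = (p * p')`_n.
Proof.
move=> pu pv; rewrite coefM; apply: eq_bigr => i _.
by rewrite pu ?pv ?leq_subr // -ltnS.
Qed.

Lemma coef_strunc n u i : (i <= n)%N -> (strunc n.+1 u)`_i = u i.
Proof. by move=> le_in; rewrite coef_poly ltnS le_in. Qed.

Lemma coef_strunc_mul n u v i :
  (i <= n)%N -> (strunc n.+1 u * strunc n.+1 v)`_i = smul u v i.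
Proof.
by move=> le_in; apply/esym/smulE => j le_ji; rewrite coef_strunc // (leq_trans le_ji).
Qed.

Lemma saddA : associative sadd.
Proof. by move=> u v w; apply/funext => n; rewrite /sadd addrA. Qed.
Lemma saddC : commutative sadd.
Proof. by move=> u v; apply/funext => n; rewrite /sadd addrC. Qed.
Lemma sadd0 : left_id szero sadd.
Proof. by move=> u; apply/funext => n; rewrite /sadd add0r. Qed.
Lemma saddN : left_inverse szero sopp sadd.
Proof. by move=> u; apply/funext => n; rewrite /sadd addNr. Qed.

HB.instance Definition _ := GRing.isZmodule.Build (series R) saddA saddC sadd0 saddN.

Lemma smulA : associative smul.
Proof.
move=> u v w; apply/funext => n.
rewrite (smulE (@coef_strunc n u) (@coef_strunc_mul n v w)) mulrA.
by rewrite (smulE (@coef_strunc_mul n u v) (@coef_strunc n w)).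
Qed.
Lemma smulC : commutative smul.
Proof.
move=> u v; apply/funext => n.
by rewrite -(@coef_strunc_mul n u v) // mulrC coef_strunc_mul.
Qed.
Lemma smul1 : left_id sone smul.
Proof.
move=> u; apply/funext => n; rewrite /smul big_ord_recl /= subn0 mul1r.
by rewrite big1 ?addr0 // => i _; rewrite mul0r.
Qed.
Lemma smulDl : left_distributive smul sadd.
Proof.
move=> u v w; apply/funext => n; rewrite /sadd /smul -big_split /=.
by apply: eq_bigr => i _; rewrite mulrDl.
Qed.
Lemma sone_neq0 : sone != 0.
Proof.
by apply/eqP => /(congr1 (fun u : series R => u 0%N)) /eqP; rewrite oner_eq0.
Qed.

HB.instance Definition _ :=
  GRing.Zmodule_isComNzRing.Build (series R) smulA smulC smul1 smulDl sone_neq0.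

Lemma scoef1 n : (1 : series R) n = (n == 0%N)%:R. Proof. by []. Qed.
Lemma scoefD u v n : (u + v) n = u n + v n. Proof. by []. Qed.
Lemma scoefB u v n : (u - v) n = u n - v n. Proof. by []. Qed.
Lemma scoefM u v n : (u * v) n = \sum_(i < n.+1) u i * v (n - i)%N.
Proof. by []. Qed.
Lemma scoef_sum (I : Type) (r : seq I) (P : pred I) (F : I -> series R) n :
  (\sum_(i <- r | P i) F i) n = \sum_(i <- r | P i) F i n.
Proof. by elim/big_rec2: _ => // i x y _ <-. Qed.
Lemma scoef0M u v : (u * v) 0%N = u 0%N * v 0%N.
Proof. by rewrite scoefM big_ord_recl big_ord0 addr0. Qed.

Definition sX n : series R := fun i => (i == n)%:R.
Definition sC (c : R) : series R := fun i => if i is 0 then c else 0.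

Lemma scoefXM n u i : (sX n * u) i = if (i < n)%N then 0 else u (i - n)%N.
Proof.
rewrite scoefM; case: ltnP => [lt_in | le_ni].
  by rewrite big1 // => j _; rewrite /sX ltn_eqF ?mul0r // (leq_trans (ltn_ord j)).
rewrite (bigD1 (inord n)) //= /sX inordK ?ltnS // eqxx mul1r.
rewrite big1 ?addr0 // => j; rewrite -val_eqE /= inordK ?ltnS // => /negPf ->.
by rewrite mul0r.
Qed.

Lemma scoefCM c u i : (sC c * u) i = c * u i.
Proof.
by rewrite scoefM big_ord_recl /= subn0 big1 ?addr0 // => j _; rewrite mul0r.
Qed.

Lemma sX0 : sX 0 = 1. Proof. by []. Qed.

Lemma sXD m n : sX (m + n)%N = sX m * sX n.
Proof.
apply/funext => i; rewrite scoefXM /sX; case: ltnP => [|le_mi].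
  by move=> lt_im; rewrite ltn_eqF // (leq_trans lt_im) ?leq_addr.
by rewrite -(subnKC le_mi) eqn_add2l addKn.
Qed.

Lemma sXX n k : sX n ^+ k = sX (n * k)%N.
Proof. elim: k => [|k IH]; first by rewrite muln0 sX0.
by rewrite exprS IH mulnS sXD. Qed.

Lemma sC_is_zmod_morphism : zmod_morphism sC.
Proof. by move=> a b; apply/funext => -[|i] //; rewrite scoefB /= subr0. Qed.
Lemma sC_is_monoid_morphism : monoid_morphism sC.
Proof.
by split=> [|a b]; apply/funext => -[|i] //; rewrite scoefCM // mulr0.
Qed.
HB.instance Definition _ := GRing.isZmodMorphism.Build R (series R) sC sC_is_zmod_morphism.
HB.instance Definition _ := GRing.isMonoidMorphism.Build R (series R) sC sC_is_monoid_morphism.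

Lemma sXI n u v : sX n * u = sX n * v -> u = v.
Proof.
move=> eq_uv; apply/funext => i; move/(congr1 (fun w : series R => w (n + i)%N)): eq_uv.
by rewrite !scoefXM ltnNge leq_addr /= addKn.
Qed.

(** Congruence modulo q^n, the q-adic notion behind all limits below. *)
Definition eqs n u v := forall i, (i < n)%N -> u i = v i.

Lemma eqsM n u u' v v' : eqs n u u' -> eqs n v v' -> eqs n (u * v) (u' * v').
Proof.
move=> uu vv i lt_in; rewrite !scoefM; apply: eq_bigr => j _.
by rewrite uu ?vv // (leq_ltn_trans _ lt_in) ?leq_subr // -ltnS.
Qed.
Lemma eqs_refl n u : eqs n u u. Proof. by []. Qed.
Lemma eqs_sym n u v : eqs n u v -> eqs n v u.
Proof. by move=> uv i /uv. Qed.
Lemma eqs_trans n u v w : eqs n u v -> eqs n v w -> eqs n u w.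
Proof. by move=> uv vw i lt_in; rewrite uv // vw. Qed.
Lemma eqs_leq m n u v : (m <= n)%N -> eqs n u v -> eqs m u v.
Proof. by move=> le_mn uv i lt_im; rewrite uv // (leq_trans lt_im). Qed.

Lemma eqs_prod n (I : Type) (r : seq I) (F G : I -> series R) :
  (forall i, eqs n (F i) (G i)) -> eqs n (\prod_(i <- r) F i) (\prod_(i <- r) G i).
Proof. by move=> FG; elim/big_rec2: _ => // i u v _ /(eqsM (FG i)). Qed.

End SeriesRing.

(** * Infinite products of power series *)

Section InfiniteProducts.
Variable R : comNzRingType.
Implicit Types (u v : series R) (P Q : nat -> series R).

(* The product of the P k, provided that P k = 1 mod q^k (see adm). *)
Definition iprod P : series R := fun n => (\prod_(k < n.+1) P k) n.

Definition adm P := forall k, eqs k (P k) 1.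

Lemma eqs_eq u v : (forall n, eqs n u v) -> u = v.
Proof. by move=> uv; apply/funext => n; apply: (uv n.+1). Qed.

(** Every factor with index at least K is 1 modulo q^K, so including it changes nothing below degree
    K. *)
Lemma iprod_trunc P K : adm P -> eqs K (iprod P) (\prod_(k < K) P k).
Proof.
move=> aP i lt_iK; rewrite /iprod -(subnKC lt_iK).
elim: (K - i.+1)%N => [|m IH]; first by rewrite addn0.
rewrite addnS [in RHS]big_ord_recr /= IH -[X in X i = _]mulr1.
have aPm : eqs i.+1 (P (i.+1 + m)%N) 1 by apply: eqs_leq (aP _); rewrite leq_addr.
exact/esym/(eqsM (@eqs_refl _ _ _) aPm).
Qed.

Lemma iprodP P u :
  adm P -> (forall n, eqs n (\prod_(k < n) P k) u) -> iprod P = u.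
Proof. by move=> aP Pu; apply: eqs_eq => n; exact: eqs_trans (iprod_trunc aP) (Pu n). Qed.

Lemma eq_iprod P Q : P =1 Q -> iprod P = iprod Q.
Proof. by move=> PQ; apply/funext => n; rewrite /iprod; under eq_bigr do rewrite PQ. Qed.

Lemma admM P Q : adm P -> adm Q -> adm (fun k => P k * Q k).
Proof. by move=> aP aQ k; rewrite -[1]mulr1; apply: eqsM. Qed.

Lemma iprodM P Q : adm P -> adm Q ->
  iprod (fun k => P k * Q k) = iprod P * iprod Q.
Proof.
move=> aP aQ; apply: iprodP (admM aP aQ) _ => n; rewrite big_split /=.
by apply/eqs_sym/eqsM; apply: iprod_trunc.
Qed.

Lemma iprod1 P : (forall k, P k = 1) -> iprod P = 1.
Proof. by move=> P1; apply/funext => n; rewrite /iprod big1. Qed.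

Lemma iprod_recl P : adm P -> iprod P = P 0%N * iprod (fun k => P k.+1).
Proof.
move=> aP; have aPS : adm (fun k => P k.+1) by move=> k; apply: (eqs_leq (leqnSn k)).
apply: iprodP => // -[|n] //; rewrite big_ord_recl; apply: eqsM => //.
apply/eqs_sym/(eqs_trans (iprod_trunc aPS)); rewrite big_ord_recr /=.
by rewrite -[X in eqs _ _ X]mulr1; apply: eqsM.
Qed.

Lemma adm_split d P : (0 < d)%N -> adm P ->
  adm (fun k => \prod_(i < d) P (d * k + i)%N).
Proof.
move=> d0 aP k /=; have p1 : \prod_(i < d) 1 = 1 :> series R by rewrite big1.
rewrite -[X in eqs _ _ X]p1.
apply: eqs_prod => i.
by apply: eqs_leq (aP _); nia.
Qed.

(** The product of the first n blocks is the product of the first d n factors, and d n >= n. This is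
    how a product gets sorted by residue classes modulo d. *)
Lemma iprod_split d P : (0 < d)%N -> adm P ->
  iprod P = iprod (fun k => \prod_(i < d) P (d * k + i)%N).
Proof.
move=> d0 aP; apply/esym/iprodP => [|n]; first exact: adm_split.
suff -> : \prod_(k < n) \prod_(i < d) P (d * k + i)%N = \prod_(k < d * n) P k.
  by apply/eqs_sym/eqs_leq/iprod_trunc => //; rewrite -[n in (n <= _)%N]mul1n leq_mul.
elim: n => [|n IH]; first by rewrite muln0 !big_ord0.
rewrite big_ord_recr /= IH mulnSr -(big_mkord xpredT) -[RHS](big_mkord xpredT).
rewrite [RHS](big_cat_nat (n := (d * n)%N)) ?leq_addr //=; congr (_ * _).
by rewrite -[in RHS](add0n (d * n)%N) big_addn add0n addKn big_mkord; apply: eq_bigr => i _; rewrite addnC.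
Qed.

Definition fac (c : R) j : series R := 1 + sC c * sX R j.
(** For j > 0 this is 1 / (1 - q^j); as an indicator sequence it is visibly nonnegative. *)
Definition geom j : series R := fun n => (j %| n)%:R.

Lemma coef_fac c j n : fac c j n = (n == 0%N)%:R + c * (n == j)%:R.
Proof. by rewrite /fac scoefD scoef1 scoefCM. Qed.

Lemma eqs_fac c j : eqs j (fac c j) 1.
Proof. by move=> i lt_ij; rewrite coef_fac (ltn_eqF lt_ij) mulr0 addr0. Qed.

Lemma eqs_geom j : eqs j (geom j) 1.
Proof.
move=> [|i] lt_ij; rewrite /geom ?dvdn0 // scoef1 gtnNdvd //.
Qed.

Lemma fac_geom j : (0 < j)%N -> fac (-1) j * geom j = 1.
Proof.
move=> j0; apply/funext => n; rewrite /fac rmorphN1 mulN1r mulrBl mul1r.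
rewrite scoefB scoefXM scoef1 /geom; case: ltnP => [lt_nj | le_jn].
  case: n lt_nj => [|n] lt_nj; first by rewrite dvdn0 subr0.
  by rewrite subr0 gtnNdvd.
by rewrite dvdn_subl // subrr; case: n le_jn => //; rewrite leqn0 => /eqP j_0; rewrite j_0 in j0.
Qed.

(** Divide 1 - x y = (1 - x) + x (1 - y) by (1 - x) (1 - y), with x = q^a and y = q^b. The
    right-hand side no longer contains a minus sign. *)
Lemma geom_pair a b : (0 < a)%N -> (0 < b)%N ->
  fac (-1) (a + b) * geom a * geom b = geom b + sX R a * geom a.
Proof.
move=> a0 b0; have -> : fac (-1) (a + b) = fac (-1) a + sX R a * fac (-1) b.
  by rewrite /fac sXD rmorphN1; ring.
have := fac_geom a0; have := fac_geom b0; move: (fac _ _) (fac _ _) => p p' pb pa.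
by ring: pa pb.
Qed.

Lemma adm_fac c (j : nat -> nat) : (forall k, k <= j k)%N -> adm (fun k => fac c (j k)).
Proof. by move=> kj k; exact: eqs_leq (kj k) (@eqs_fac _ _). Qed.

Lemma adm_geom (j : nat -> nat) : (forall k, k <= j k)%N -> adm (fun k => geom (j k)).
Proof. by move=> kj k; exact: eqs_leq (kj k) (@eqs_geom _). Qed.

End InfiniteProducts.

(** The first hypothesis is q-adic continuity, which lets a ring morphism pass to the limit of the
    partial products. *)
Lemma iprod_morph (R S : comNzRingType) (h : {rmorphism series R -> series S}) P :
  (forall n u v, eqs n u v -> eqs n (h u) (h v)) -> adm P ->
  h (iprod P) = iprod (h \o P).
Proof.
move=> h_eqs aP; apply/esym/iprodP => [k|n].
  by rewrite /= -(rmorph1 h); apply: h_eqs.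
by rewrite -rmorph_prod; apply/h_eqs/eqs_sym/iprod_trunc.
Qed.

(** * The substitutions q -> q^2 ([dil]) and q -> -q ([alt]), and change of coefficients *)

Section Morphisms.
Variable R : comNzRingType.
Implicit Types u v : series R.

Definition dil u : series R := fun n => if odd n then 0 else u n./2.
Definition alt u : series R := fun n => (-1) ^+ n * u n.

Lemma dil_zmod_morphism : zmod_morphism dil.
Proof.
by move=> u v; apply/funext => n; rewrite /dil !scoefB; case: odd; rewrite ?subr0.
Qed.

Lemma dil_monoid_morphism : monoid_morphism dil.
Proof.
split=> [|u v]; apply/funext => n; last first.
  (* On truncations, q -> q^2 is composition of polynomials with 'X^2, which is already known to be
     multiplicative. *)
  have dilE i w : (i <= n)%N -> (strunc n.+1 w \Po 'X^2)`_i = dil w i.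
    move=> le_in; rewrite coef_comp_poly_Xn // /dil dvdn2 divn2; case: odd => //.
    by rewrite coef_strunc //; lia.
  rewrite -[RHS]/(smul (dil u) (dil v) n) (smulE (fun i => @dilE i u) (fun i => @dilE i v)).
  rewrite -rmorphM /= coef_comp_poly_Xn // /dil dvdn2 divn2; case: odd => //=.
  by rewrite coef_strunc_mul // -divn2 leq_div.
by rewrite /dil !scoef1; case: n => [|[|n]] //=; case: odd.
Qed.

HB.instance Definition _ :=
  GRing.isZmodMorphism.Build (series R) (series R) dil dil_zmod_morphism.
HB.instance Definition _ :=
  GRing.isMonoidMorphism.Build (series R) (series R) dil dil_monoid_morphism.

Lemma dil_eqs n u v : eqs n u v -> eqs n (dil u) (dil v).
Proof.
by move=> uv i lt_in; rewrite /dil; case: odd => //; apply: uv; lia.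
Qed.

Lemma dil_fac c j : dil (fac c j) = fac c j.*2.
Proof.
apply/funext => n; rewrite /dil !coef_fac; case: ifP => odd_n.
  have [-> ->] : (n == 0%N) = false /\ (n == j.*2) = false.
    by split; apply: contraTF odd_n => /eqP->; rewrite ?odd_double.
  by rewrite mulr0 addr0.
rewrite -[n in RHS]odd_double_half odd_n add0n double_eq0.
by rewrite -!muln2 eqn_pmul2r.
Qed.

Lemma alt_zmod_morphism : zmod_morphism alt.
Proof. by move=> u v; apply/funext => n; rewrite /alt !scoefB mulrBr. Qed.

Lemma alt_monoid_morphism : monoid_morphism alt.
Proof.
split=> [|u v]; apply/funext => n; rewrite /alt.
  by rewrite scoef1; case: n => [|n]; rewrite ?mulr0 // mulr1.
rewrite !scoefM mulr_sumr; apply: eq_bigr => i _.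
have /subnKC {1}<- : (i <= n)%N by rewrite -ltnS.
by rewrite exprD; ring.
Qed.

HB.instance Definition _ :=
  GRing.isZmodMorphism.Build (series R) (series R) alt alt_zmod_morphism.
HB.instance Definition _ :=
  GRing.isMonoidMorphism.Build (series R) (series R) alt alt_monoid_morphism.

Lemma alt_eqs n u v : eqs n u v -> eqs n (alt u) (alt v).
Proof. by move=> uv i lt_in; rewrite /alt uv. Qed.

Lemma alt_fac c j : alt (fac c j) = fac ((-1) ^+ j * c) j.
Proof.
apply/funext => n; rewrite /alt !coef_fac mulrDr mulrA; congr (_ + _).
  by case: n => [|n]; rewrite ?mulr0 // mulr1.
by case: eqP => [->|]; rewrite ?mulr0.
Qed.

Lemma altK : involutive alt.
Proof. by move=> u; apply/funext => n; rewrite /alt mulrA -expr2 sqrr_sign mul1r. Qed.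

Lemma alt_dil u : alt (dil u) = dil u.
Proof.
apply/funext => n; rewrite /alt /dil; case: ifP => odd_n; rewrite ?mulr0 //.
by rewrite -signr_odd odd_n mul1r.
Qed.

Lemma sX_dil n u : (sX R 1 * dil u) n = if odd n then u n./2 else 0.
Proof.
rewrite scoefXM; case: n => [|n] //=; rewrite subn1 /dil /= uphalf_half.
by case: odd.
Qed.

End Morphisms.

Section SeriesMap.
Variables (R S : comNzRingType) (h : {rmorphism R -> S}).

Definition smap (u : series R) : series S := fun n => h (u n).

Lemma smap_zmod_morphism : zmod_morphism smap.
Proof. by move=> u v; apply/funext => n; rewrite /smap !scoefB rmorphB. Qed.

Lemma smap_monoid_morphism : monoid_morphism smap.
Proof.
split=> [|u v]; apply/funext => n; rewrite /smap; first by rewrite scoef1 rmorph_nat.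
by rewrite !scoefM rmorph_sum; apply: eq_bigr => i _; rewrite rmorphM.
Qed.

HB.instance Definition _ :=
  GRing.isZmodMorphism.Build (series R) (series S) smap smap_zmod_morphism.
HB.instance Definition _ :=
  GRing.isMonoidMorphism.Build (series R) (series S) smap smap_monoid_morphism.

Lemma smap_eqs n u v : eqs n u v -> eqs n (smap u) (smap v).
Proof. by move=> uv i lt_in; rewrite /smap uv. Qed.

Lemma smap_fac c j : smap (fac c j) = fac (h c) j.
Proof. by apply/funext => n; rewrite /smap !coef_fac rmorphD rmorphM !rmorph_nat. Qed.

Lemma smap_geom j : smap (geom R j) = geom S j.
Proof. by apply/funext => n; rewrite /smap /geom rmorph_nat. Qed.

Lemma smap_sX j : smap (sX R j) = sX S j.
Proof. by apply/funext => n; rewrite /smap /sX rmorph_nat. Qed.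

Lemma smap_inj : injective h -> injective smap.
Proof.
by move=> h_inj u v uv; apply/funext => n; apply: h_inj; move/(congr1 (@^~ n)): uv.
Qed.

End SeriesMap.

Lemma iprod_bigM (R : comNzRingType) (I : Type) (r : seq I) (P : I -> nat -> series R) :
  (forall i, adm (P i)) ->
  iprod (fun k => \prod_(i <- r) P i k) = \prod_(i <- r) iprod (P i).
Proof.
move=> aP; elim: r => [|i r IH].
  by rewrite big_nil iprod1 // => k; rewrite big_nil.
rewrite big_cons -IH -iprodM //; first by apply: eq_iprod => k; rewrite big_cons.
move=> k; elim: r {IH} => [|j r IH]; first by rewrite big_nil.
by rewrite big_cons -[X in eqs _ _ X]mul1r; apply: eqsM => //; apply: aP.
Qed.

(** * Eta products and q-Pochhammer symbols *)

Section EtaProducts.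
Variable R : comNzRingType.

(* (-c q^r; q^d)_oo *)
Definition qpoch (c : R) r d : series R := iprod (fun k => fac c (r + d * k)%N).
(** [ef j] is f_j and [eg j] is 1 / f_j. An eta quotient is written as a monomial in both, so that
    [ring] can simplify it modulo the relations [ef_eg]. *)
Definition ef j := qpoch (-1) j j.
Definition eg j : series R := iprod (fun k => geom R (j + j * k)%N).

Lemma adm_qpoch (c : R) r d : (0 < d)%N -> adm (fun k => fac c (r + d * k)%N).
Proof. by move=> d0; apply: adm_fac => k; nia. Qed.

Lemma qpoch_split m c r d : (0 < m)%N -> (0 < d)%N ->
  qpoch c r d = \prod_(i < m) qpoch c (r + d * i)%N (m * d)%N.
Proof.
move=> m0 d0; rewrite /qpoch (iprod_split m0 (adm_qpoch _ _ d0)) -iprod_bigM.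
  by apply: eq_iprod => k; apply: eq_bigr => i _; congr (fac c _); ring.
by move=> i; apply: adm_qpoch; rewrite muln_gt0 m0.
Qed.

Lemma qpoch_split2 c r d : (0 < d)%N ->
  qpoch c r d = qpoch c r (2 * d)%N * qpoch c (r + d)%N (2 * d)%N.
Proof.
move=> d0; rewrite (@qpoch_split 2) // big_ord_recl big_ord1 /=.
by rewrite muln0 addn0 muln1.
Qed.

Lemma qpoch_split3 c r d : (0 < d)%N ->
  qpoch c r d = qpoch c r (3 * d)%N * qpoch c (r + d)%N (3 * d)%N
                * qpoch c (r + d * 2)%N (3 * d)%N.
Proof.
move=> d0; rewrite (@qpoch_split 3) // !big_ord_recl big_ord0 /=.
by rewrite muln0 addn0 muln1 mulr1 mulrA.
Qed.

Lemma qpoch_sqr r d : (0 < d)%N ->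
  qpoch 1 r d * qpoch (-1) r d = qpoch (-1) (2 * r)%N (2 * d)%N.
Proof.
move=> d0; rewrite -iprodM; try exact: adm_qpoch.
apply: eq_iprod => k; rewrite /fac rmorphN1 rmorph1.
have -> : (2 * r + 2 * d * k = (r + d * k) + (r + d * k))%N by ring.
by rewrite [sX R (r + d * k + _)%N]sXD; ring.
Qed.

(** The factor of exponent 0 is the constant 1 + c. It is the source of the scalars 2, 1 - w and 1 +
    w in the theta products below. *)
Lemma qpoch0 c d : (0 < d)%N -> qpoch c 0 d = sC (1 + c) * qpoch c d d.
Proof.
move=> d0; rewrite /qpoch iprod_recl; last exact: adm_qpoch.
rewrite muln0 addn0 /fac sX0 mulr1 rmorphD rmorph1; congr (_ * _).
by apply: eq_iprod => k; rewrite mulnS.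
Qed.

Lemma ef_eg j : (0 < j)%N -> ef j * eg j = 1.
Proof.
move=> j0; rewrite -iprodM; [|exact: adm_qpoch|by apply: adm_geom => k; nia].
by apply: iprod1 => k; rewrite fac_geom // addn_gt0 j0.
Qed.

Lemma ef_mulI j (u v : series R) : (0 < j)%N -> ef j * u = ef j * v -> u = v.
Proof.
move=> /ef_eg fg /(congr1 ( *%R (eg j))).
by rewrite !mulrA ![eg j * _]mulrC fg !mul1r.
Qed.

Lemma qpoch1_ef j : (0 < j)%N -> qpoch 1 j j = ef (2 * j)%N * eg j.
Proof. by move=> j0; have := qpoch_sqr j j0; have := ef_eg j0; rewrite -!/(ef _) => h <-; ring: h. Qed.

Lemma qpochN1_odd j : (0 < j)%N -> qpoch (-1) j (2 * j)%N = ef j * eg (2 * j)%N.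
Proof.
move=> j0; have j20 : (0 < 2 * j)%N by rewrite muln_gt0.
have := qpoch_split2 (-1) j j0; rewrite (_ : j + j = 2 * j)%N ?mul2n ?addnn // -!/(ef _).
by rewrite -mul2n; have := ef_eg j20 => h ->; ring: h.
Qed.

(** Split (-q^j; q^j)_oo = f_(2j) / f_j into odd and even multiples of j; the even ones give f_(4j)
    / f_(2j), and dividing by this leaves the odd ones. *)
Lemma qpoch1_odd j : (0 < j)%N ->
  qpoch 1 j (2 * j)%N = ef (2 * j)%N ^+ 2 * eg j * eg (4 * j)%N.
Proof.
move=> j0; have j20 : (0 < 2 * j)%N by rewrite muln_gt0.
have j40 : (0 < 4 * j)%N by rewrite muln_gt0.
have := qpoch_split2 1 j j0; rewrite (_ : j + j = 2 * j)%N ?mul2n ?addnn //.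
rewrite -mul2n (qpoch1_ef j0) (qpoch1_ef j20) (_ : (2 * (2 * j) = 4 * j)%N) ?mulnA // => h.
have h2 := ef_eg j20; have h4 := ef_eg j40.
transitivity (ef (2 * j)%N * eg (4 * j)%N * (ef (2 * j)%N * eg j)).
  by rewrite h; ring: h2 h4.
by ring.
Qed.

End EtaProducts.

(** * Nonnegativity and positivity of coefficients *)

Section Nonnegative.
Implicit Types u v : series int.

Definition nonneg u := forall n, 0 <= u n.

Lemma nonnegM u v : nonneg u -> nonneg v -> nonneg (u * v).
Proof. by move=> u0 v0 n; rewrite scoefM sumr_ge0 // => i _; rewrite mulr_ge0. Qed.

Lemma nonneg1 : nonneg 1.
Proof. by move=> n; rewrite scoef1 ler0n. Qed.

Lemma scoefM_gt0 u v i j : nonneg u -> nonneg v -> 0 < u i -> 0 < v j ->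
  0 < (u * v) (i + j)%N.
Proof.
move=> u0 v0 ui vj; rewrite scoefM.
have lt_i : (i < (i + j).+1)%N by rewrite ltnS leq_addr.
rewrite (bigD1 (Ordinal lt_i)) //= addKn ltr_pwDl ?mulr_gt0 //.
by rewrite sumr_ge0 // => k _; rewrite mulr_ge0.
Qed.

Lemma nonneg_prod (I : Type) (r : seq I) (Q : pred I) (P : I -> series int) :
  (forall k, nonneg (P k)) -> nonneg (\prod_(k <- r | Q k) P k).
Proof. by move=> P0; apply: big_ind => [||k _]; [exact: nonneg1 | exact: nonnegM | exact: P0]. Qed.

Lemma nonneg_iprod (P : nat -> series int) : (forall k, nonneg (P k)) -> nonneg (iprod P).
Proof. by move=> P0 n; apply: nonneg_prod. Qed.

(** The term q^i of the factor k times the constant terms of all other factors already contributes,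
    and nothing cancels it. *)
Lemma iprod_gt0 (P : nat -> series int) k i : adm P -> (forall j, nonneg (P j)) ->
  (forall j, 0 < P j 0%N) -> 0 < P k i -> 0 < iprod P i.
Proof.
(* K exceeds k, so that the factor k is present, and exceeds i, so that the truncation is exact in
   degree i. *)
move=> aP P0 P1 Pki; pose K := (maxn k i).+1.
have lt_kK : (k < K)%N by rewrite ltnS leq_maxl.
rewrite (iprod_trunc (K := K) aP); last by rewrite ltnS leq_maxr.
rewrite (bigD1 (Ordinal lt_kK)) //= -[i]addn0.
apply: scoefM_gt0 => //; first exact: nonneg_prod.
by elim/big_ind: _ => // u v u0 v0; rewrite scoef0M mulr_gt0.
Qed.

Lemma nonneg_fac j : nonneg (fac 1 j).
Proof. by move=> n; rewrite coef_fac mul1r addr_ge0 ?ler0n. Qed.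

Lemma nonneg_geom j : nonneg (geom int j).
Proof. by move=> n; rewrite /geom ler0n. Qed.

Lemma nonneg_qpoch1 r d : nonneg (qpoch 1 r d).
Proof. by apply: nonneg_iprod => k; apply: nonneg_fac. Qed.

Lemma nonneg_eg j : nonneg (eg int j).
Proof. by apply: nonneg_iprod => k; apply: nonneg_geom. Qed.

Lemma fac1_gt0 j i : (i == 0)%N || (i == j) -> 0 < fac (1 : int) j i.
Proof. by rewrite coef_fac mul1r; case: eqP; case: eqP. Qed.

Lemma qpoch1_gt0 r d i k : (0 < d)%N -> (i == 0)%N || (i == r + d * k)%N ->
  0 < qpoch (1 : int) r d i.
Proof.
move=> d0 ik; apply: (@iprod_gt0 _ k) => [|j|j|]; first exact: adm_qpoch.
- exact: nonneg_fac.
- exact: fac1_gt0.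
- exact: fac1_gt0.
Qed.

Lemma eg_gt0 j k : (0 < j)%N -> 0 < eg int j (j * k)%N.
Proof.
move=> j0; apply: (@iprod_gt0 _ 0) => [|i|i|]; first by apply: adm_geom => i; nia.
- exact: nonneg_geom.
- by rewrite /geom dvdn0.
- by rewrite /geom muln0 addn0 dvdn_mulr.
Qed.

End Nonnegative.

(** * Action of the substitutions on f_j and 1 / f_j *)

Section Transfer.

Lemma dil_ef (R : comNzRingType) j : (0 < j)%N -> dil (ef R j) = ef R (2 * j)%N.
Proof.
move=> j0; rewrite /ef /qpoch (iprod_morph (@dil_eqs R) (adm_qpoch _ _ j0)).
by apply: eq_iprod => k /=; rewrite dil_fac -mul2n mulnDr mulnA.
Qed.

Lemma dil_eg (R : comNzRingType) j : (0 < j)%N -> dil (eg R j) = eg R (2 * j)%N.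
Proof.
move=> j0; have j20 : (0 < 2 * j)%N by rewrite muln_gt0.
apply: (@ef_mulI _ (2 * j)%N) => //.
by rewrite ef_eg // -dil_ef // -rmorphM /= ef_eg // rmorph1.
Qed.

(** Write f_j = (q^j; q^(2j))_oo f_(2j). For odd j all exponents in the first product are odd and
    change sign, while f_(2j) is a series in q^2 and stays fixed. *)
Lemma alt_ef_odd (R : comNzRingType) j : odd j ->
  alt (ef R j) = ef R (2 * j)%N ^+ 3 * eg R j * eg R (4 * j)%N.
Proof.
move=> oj; have j0 := odd_gt0 oj.
have j20 : (0 < 2 * j)%N by rewrite muln_gt0.
have -> : ef R j = qpoch (-1) j (2 * j)%N * ef R (2 * j)%N.
  by rewrite qpochN1_odd //; have := ef_eg R j20 => h; ring: h.
have -> : ef R (2 * j)%N = dil (ef R j) by rewrite dil_ef.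
rewrite rmorphM /= alt_dil dil_ef //.
have -> : alt (qpoch (-1) j (2 * j)%N) = qpoch (1 : R) j (2 * j)%N.
  rewrite /qpoch (iprod_morph (@alt_eqs R) (adm_qpoch _ _ j20)).
  apply: eq_iprod => k /=; rewrite alt_fac -signr_odd oddD -mulnA mul2n odd_double oj.
  by rewrite mulrN1 opprK.
by rewrite qpoch1_odd //; ring.
Qed.

Lemma alt_ef_even (R : comNzRingType) j : (0 < j)%N ->
  alt (ef R (2 * j)%N) = ef R (2 * j)%N.
Proof. by move=> j0; rewrite -dil_ef // alt_dil. Qed.

Lemma alt_eg_even (R : comNzRingType) j : (0 < j)%N ->
  alt (eg R (2 * j)%N) = eg R (2 * j)%N.
Proof. by move=> j0; rewrite -dil_eg // alt_dil. Qed.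

Lemma alt_eg_odd (R : comNzRingType) j : odd j ->
  alt (eg R j) = ef R j * ef R (4 * j)%N * eg R (2 * j)%N ^+ 3.
Proof.
move=> oj; have j0 := odd_gt0 oj.
have j20 : (0 < 2 * j)%N by rewrite muln_gt0.
have j40 : (0 < 4 * j)%N by rewrite muln_gt0.
have h1 := ef_eg R j0; have h2 := ef_eg R j20; have h4 := ef_eg R j40.
have : alt (ef R j) * alt (eg R j) = 1 by rewrite -rmorphM /= h1 rmorph1.
rewrite alt_ef_odd // => h.
transitivity ((ef R j * ef R (4 * j)%N * eg R (2 * j)%N ^+ 3) *
  (ef R (2 * j)%N ^+ 3 * eg R j * eg R (4 * j)%N * alt (eg R j))).
  by ring: h1 h2 h4.
by rewrite h mulr1.
Qed.

Lemma smap_ef (R S : comNzRingType) (h : {rmorphism R -> S}) j : (0 < j)%N ->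
  smap h (ef R j) = ef S j.
Proof.
move=> j0; rewrite /ef /qpoch (iprod_morph (@smap_eqs _ _ h) (adm_qpoch _ _ j0)).
by apply: eq_iprod => k /=; rewrite smap_fac rmorphN1.
Qed.

Lemma smap_eg (R S : comNzRingType) (h : {rmorphism R -> S}) j : (0 < j)%N ->
  smap h (eg R j) = eg S j.
Proof.
move=> j0; have aj : adm (fun k => geom R (j + j * k)%N) by apply: adm_geom => k; nia.
rewrite /eg (iprod_morph (@smap_eqs _ _ h) aj).
by apply: eq_iprod => k /=; rewrite smap_geom.
Qed.

End Transfer.

(** * Translation of [eta_quotient] into products of [ef] and [eg] *)

Section Eta.

Definition spoly (p : {poly int}) : series int := fun n => p`_n.

Lemma spoly_zmod_morphism : zmod_morphism spoly.
Proof. by move=> p q; apply/funext => n; rewrite /spoly coefB. Qed.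

Lemma spoly_monoid_morphism : monoid_morphism spoly.
Proof.
split=> [|p q]; apply/funext => n; first by rewrite /spoly coef1.
by rewrite /spoly coefM.
Qed.

HB.instance Definition _ :=
  GRing.isZmodMorphism.Build {poly int} (series int) spoly spoly_zmod_morphism.
HB.instance Definition _ :=
  GRing.isMonoidMorphism.Build {poly int} (series int) spoly spoly_monoid_morphism.

Lemma euler_f_ef j : (0 < j)%N -> euler_f j = ef int j.
Proof.
(* [iprod] takes n + 1 factors in degree n where [euler_f] takes n; [euler_fE] supplies the extra
   one. *)
move=> j0; apply/funext => n; rewrite -(euler_fE j0 (leqnSn n)).
rewrite -[LHS]/(spoly _ n) /euler_partial big_add1 big_mkord rmorph_prod.
rewrite /ef /qpoch /iprod; congr ((_ : series int) n); apply: eq_bigr => k _.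
apply/funext => i; rewrite /= /spoly coef_fac coefB coef1 coefXn mulN1r.
by rewrite mulnS.
Qed.

Lemma fps_mulE (u v : series int) : fps_mul u v = u * v.
Proof. by []. Qed.

Lemma fps_expE (u : series int) k : fps_exp u k = u ^+ k.
Proof. by elim: k => //= k IH; rewrite exprS -IH. Qed.

Lemma fps_inv_ef j : (0 < j)%N -> fps_inv (ef int j) = eg int j.
Proof.
move=> j0; apply: (@ef_mulI _ j) => //; rewrite ef_eg // -euler_f_ef //.
by apply/funext => n; rewrite -fps_mulE fps_mulrV // euler_f0 unitr1.
Qed.

Definition efz j (z : int) : series int :=
  match z with Posz k => ef int j ^+ k | Negz k => eg int j ^+ k.+1 end.

Lemma eta_quotientE t1 t2 t3 t4 : eta_quotient [:: t1; t2; t3; t4] =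
  efz 1 t1 * efz 2 t2 * efz 3 t3 * efz 4 t4.
Proof.
have expzE j z : (0 < j)%N -> fps_expz (euler_f j) z = efz j z.
  by move=> j0; case: z => k; rewrite /fps_expz fps_expE euler_f_ef // fps_inv_ef.
rewrite /eta_quotient !big_ord_recl big_ord0 /= !expzE // !fps_mulE.
by rewrite -[fps1]/(1 : series int) mulr1 !mulrA.
Qed.

End Eta.

(** * Formal sums of monomials over an arbitrary index set *)

Section FormalSums.
Variable R : comNzRingType.

(* u is the formal sum of the monomials w i * q^(e i), the sum being finite in each degree *)
Definition has_sum (I : eqType) (w : I -> R) (e : I -> nat) (u : series R) :=
  forall N, exists r : seq I, [/\ uniq r, forall i, (e i <= N)%N -> i \in r &
    forall k, (k <= N)%N -> u k = \sum_(i <- r | e i == k) w i].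

(** Any two witness lists, filtered to the indices of exponent N, are duplicate-free lists of the
    same set, hence permutations of each other. *)
Lemma has_sum_uniq (I : eqType) (w : I -> R) e u v :
  has_sum w e u -> has_sum w e v -> u = v.
Proof.
move=> uS vS; apply/funext => N.
have [r [r_uniq rP ->]] := uS N; last by [].
have [s [s_uniq sP ->]] := vS N; last by [].
rewrite -[LHS]big_filter -[RHS]big_filter; apply: perm_big.
apply: uniq_perm => [||i]; rewrite ?filter_uniq // !mem_filter.
by case: eqP => //= eiN; rewrite rP ?sP ?eiN.
Qed.

Lemma has_sumM (I J : eqType) (w : I -> R) e (w' : J -> R) e' u v :
  has_sum w e u -> has_sum w' e' v ->
  has_sum (fun p => w p.1 * w' p.2) (fun p => e p.1 + e' p.2)%N (u * v).
Proof.
move=> uS vS N; have [r [r_uniq rP ru]] := uS N; have [s [s_uniq sP sv]] := vS N.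
exists (allpairs pair r s); split=> [|[i j] /= le_ijN|k le_kN].
- by apply: allpairs_uniq => // -[i j] [i' j'] _ _ [-> ->].
- apply/allpairsP; exists (i, j); split=> //=.
    by apply: rP; rewrite (leq_trans _ le_ijN) ?leq_addr.
  by apply: sP; rewrite (leq_trans _ le_ijN) ?leq_addl.
rewrite big_mkcond big_allpairs /= scoefM.
(* Both sides become sums over pairs (i, j); a pair of total exponent k is counted for exactly one
   a, namely [e i]. *)
transitivity (\sum_(a < k.+1) \sum_(i <- r) \sum_(j <- s)
   if (e i == a) && (e' j == k - a)%N then w i * w' j else 0).
  apply: eq_bigr => a _; have le_ak : (a <= k)%N by rewrite -ltnS.
  rewrite ru ?(leq_trans le_ak) // sv ?(leq_trans (leq_subr _ _)) //.
  rewrite big_distrlr /= big_mkcond; apply: eq_bigr => i _.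
  by case: ifP => /= _; rewrite ?[LHS]big_mkcond // big1.
rewrite exchange_big; apply: eq_bigr => i _; rewrite exchange_big.
apply: eq_bigr => j _; case: eqP => [eijk | neq].
  have lt_ik : (e i < k.+1)%N by rewrite ltnS -eijk leq_addr.
  rewrite (bigD1 (Ordinal lt_ik)) //= eqxx big1 ?addr0 => [|a]; last first.
    by rewrite -val_eqE /= eq_sym => /negPf ->.
  by rewrite -{1}eijk addKn eqxx.
rewrite big1 // => a _; case: andP => // -[/eqP eia /eqP ejk].
by case: neq; rewrite eia ejk subnKC // -ltnS.
Qed.

Lemma has_sum_bij (I J : eqType) (h : J -> I) (w : I -> R) e w' e' u :
  bijective h -> w \o h =1 w' -> e \o h =1 e' -> has_sum w e u -> has_sum w' e' u.
Proof.
move=> [g hK gK] ww ee uS N; have [r [r_uniq rP ru]] := uS N.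
exists (map g r); split=> [|j le_jN|k le_kN].
- by rewrite map_inj_uniq //; apply: can_inj gK.
- by rewrite -[j]hK; apply/map_f/rP; rewrite -[e _]/((e \o h) j) ee.
rewrite ru // big_map; apply: eq_big => i; first by rewrite -ee /= gK.
by rewrite -ww /= gK.
Qed.

Lemma has_sumD (I J : eqType) (w : I -> R) e (w' : J -> R) e' u v :
  has_sum w e u -> has_sum w' e' v ->
  has_sum (fun s => match s with inl i => w i | inr j => w' j end)
          (fun s => match s with inl i => e i | inr j => e' j end) (u + v).
Proof.
move=> uS vS N; have [r [r_uniq rP ru]] := uS N; have [s [s_uniq sP sv]] := vS N.
exists (map inl r ++ map inr s); split=> [|[i|j] le_N|k le_kN].
- rewrite cat_uniq !map_inj_uniq ?r_uniq ?s_uniq; try by move=> ? ? [].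
  by rewrite andbT; apply/hasPn => _ /mapP[j _ ->]; apply/mapP => -[].
- by rewrite mem_cat map_f // rP.
- by rewrite mem_cat orbC map_f // sP.
by rewrite big_cat !big_map scoefD ru ?sv.
Qed.

Lemma has_sumZ (I : eqType) (w : I -> R) e u c d :
  has_sum w e u -> has_sum (fun i => c * w i) (fun i => d + e i)%N (sC c * sX R d * u).
Proof.
move=> uS N; have [r [r_uniq rP ru]] := uS N.
exists r; split=> // [i le_N | k le_kN]; first by rewrite rP // (leq_trans _ le_N) ?leq_addl.
rewrite -mulrA scoefCM scoefXM; case: ltnP => [lt_kd | le_dk].
  by rewrite mulr0 big1 // => i /eqP eik; rewrite -eik ltnNge leq_addr in lt_kd.
rewrite ru ?(leq_trans (leq_subr _ _)) // mulr_sumr; apply: eq_bigl => i.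
by rewrite -[k in RHS](subnKC le_dk) eqn_add2l.
Qed.

End FormalSums.

(** * Gaussian binomials and the q-binomial theorem *)

Section GaussianBinomials.
Variables (A : comNzRingType) (q : A).

(** The q-Pascal recurrence avoids division, so it makes sense in any commutative ring; [qbin_fact]
    recovers the quotient of q-factorials. *)
Fixpoint qbin (m k : nat) : A :=
  match m, k with
  | _, 0 => 1
  | 0, _.+1 => 0
  | m'.+1, k'.+1 => qbin m' k' + q ^+ k * qbin m' k
  end.

Definition qfact n : A := \prod_(i < n) (1 - q ^+ i.+1).

Lemma qbin0 m : qbin m 0 = 1. Proof. by case: m. Qed.

Lemma qbin_small m k : (m < k)%N -> qbin m k = 0.
Proof.
elim: m k => [|m IH] [|k] //= lt_mk.
by rewrite !IH ?mulr0 ?addr0 // ltnW.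
Qed.

Lemma qbin_fact m k : (k <= m)%N -> qbin m k * qfact k * qfact (m - k) = qfact m.
Proof.
elim: m k => [|m IH] [|k] le_km; rewrite ?qbin0 ?subn0 /qfact ?big_ord0 ?mulr1 ?mul1r //.
rewrite -/(qfact _) subSS [qbin _ _]/= mulrDl mulrDl.
have qfactS n : qfact n.+1 = qfact n * (1 - q ^+ n.+1) by rewrite /qfact big_ord_recr.
rewrite -!/(qfact _) (qfactS m).
have -> : qbin m k * qfact k.+1 * qfact (m - k) = qfact m * (1 - q ^+ k.+1).
  by rewrite -(IH k) // qfactS; ring.
move: le_km; rewrite ltnS leq_eqVlt => /predU1P[->|lt_km].
  by rewrite qbin_small // mulr0 !mul0r addr0.
have -> : q ^+ k.+1 * qbin m k.+1 * qfact k.+1 * qfact (m - k)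
        = q ^+ k.+1 * qfact m * (1 - q ^+ (m - k)).
  by rewrite -(IH k.+1) // -(subnSK lt_km) !qfactS; ring.
have -> : q ^+ m.+1 = q ^+ k.+1 * q ^+ (m - k) by rewrite -exprD addSn subnKC // ltnW.
by ring.
Qed.

(** Removing the factor u + v leaves the same product with v replaced by v q, so the induction
    generalizes over v. *)
Lemma qbinomial m (u v : A) : \prod_(k < m) (u + v * q ^+ k) =
  \sum_(k < m.+1) qbin m k * q ^+ 'C(k, 2) * v ^+ k * u ^+ (m - k).
Proof.
elim: m v => [|m IH] v; first by rewrite big_ord0 big_ord1 /=; ring.
rewrite big_ord_recl expr0 mulr1.
transitivity ((u + v) * \prod_(k < m) (u + (v * q) * q ^+ k)).
  by congr (_ * _); apply: eq_bigr => k _; rewrite exprS mulrA.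
rewrite IH mulrDl !mulr_sumr big_ord_recl [RHS]big_ord_recl /=.
rewrite !qbin0 subn0 -addrA; congr (_ + _); first by rewrite exprS; ring.
transitivity (\sum_(k < m.+1) (u * (qbin m k.+1 * q ^+ 'C(k.+1, 2) * (v * q) ^+ k.+1 * u ^+ (m - k.+1))
  + v * (qbin m k * q ^+ 'C(k, 2) * (v * q) ^+ k * u ^+ (m - k)))).
  rewrite big_split /=; congr (_ + _); rewrite big_ord_recr /=.
  by rewrite qbin_small // !mul0r mulr0 addr0.
apply: eq_bigr => k _; rewrite /bump /= add1n subSS binS bin1 !exprMn !exprD.
case: (ltnP k m) => [lt_km | le_mk].
  by rewrite -(subnSK lt_km) !exprS; ring.
by rewrite qbin_small ?ltnS // !exprS; ring.
Qed.

End GaussianBinomials.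

Arguments qbin : simpl never.

(** * The Jacobi triple product and the product of two theta series *)

Section JacobiTripleProduct.
Variable F : fieldType.
Implicit Types (D r : nat) (c : F).

(** The exponent D n (n - 1) / 2 + r n of T_(D,r) as a natural number. For n = -(m + 1) it equals D
    (m + 1) (m + 2) / 2 - r (m + 1), rearranged so that only D - r is subtracted; this is faithful
    for r <= D. *)
Definition texp D r (n : int) : nat :=
  match n with
  | Posz m => D * 'C(m, 2) + r * m
  | Negz m => D * 'C(m.+1, 2) + (D - r) * m.+1
  end.

Lemma double_bin2 n : (2 * 'C(n, 2) + n = n * n)%N.
Proof. by elim: n => // n IH; rewrite binS bin1; nia. Qed.

Lemma texpE D r n : (r <= D)%N ->
  2 * (texp D r n)%:Z = D%:Z * n * (n - 1) + 2 * r%:Z * n.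
Proof.
move=> le_rD; case: n => m; rewrite /texp ?NegzE.
  have := double_bin2 m; nia.
have := double_bin2 m.+1; nia.
Qed.

(** Gives local finiteness of the theta series. The successor is needed: for r = 0 the exponent at n
    = 1 is 0. *)
Lemma texp_ge D r n : (0 < D)%N -> (`|n| <= (texp D r n).+1)%N.
Proof.
have bin_ge m : (m <= 'C(m, 2).+1)%N by case: m => // m; rewrite binS bin1 -addnS leq_addl.
by move=> D0; case: n => m; rewrite /texp ?abszN /=; have := bin_ge m; have := bin_ge m.+1; nia.
Qed.


Definition is_theta D r c (u : series F) := has_sum (fun n : int => c ^ n) (texp D r) u.

Lemma monomialI c n (u v : series F) :
  c != 0 -> sC c * sX F n * u = sC c * sX F n * v -> u = v.
Proof.
move=> c0 eq_uv; apply: (@sXI _ n); move/(congr1 ( *%R (sC c^-1))): eq_uv.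
by rewrite !mulrA -!rmorphM /= mulVf // rmorph1 !mul1r.
Qed.

Lemma sX_bin2 D m : \prod_(i < m) sX F (D * i)%N = sX F (D * 'C(m, 2))%N.
Proof.
elim: m => [|m IH]; first by rewrite big_ord0 muln0.
by rewrite big_ord_recr /= IH -sXD binS bin1 mulnDr.
Qed.

(** The q-binomial theorem in base q^D with 2 (N + 1) factors u + q^(D i), where u = c^-1 q^(D - r +
    D N). In the first half q^(D i) is pulled out of each factor, in the second half u; what remains
    are the two products on the left. *)
Lemma finite_triple_product D r c N : (r <= D)%N -> c != 0 ->
  (\prod_(i < N.+1) fac c^-1 (D - r + D * i)%N) * (\prod_(i < N.+1) fac c (r + D * i)%N) =
  \sum_(k < (N.+1 + N.+1).+1) qbin (sX F D) (N.+1 + N.+1) k *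
     (sC (c ^ (k%:Z - N.+1%:Z)) * sX F (texp D r (k%:Z - N.+1%:Z))).
Proof.
move=> le_rD c0; pose u := sC c^-1 * sX F (D - r + D * N)%N.
have c'0 : c^-1 ^+ N.+1 != 0 by rewrite expf_neq0 ?invr_neq0.
(* The monomial gathers everything pulled out of the 2 (N + 1) factors. *)
apply: (@monomialI (c^-1 ^+ N.+1) (D * 'C(N.+1, 2) + (D - r + D * N) * N.+1)%N) => //.
have := qbinomial (sX F D) (N.+1 + N.+1) u 1.
rewrite big_split_ord /= => h.
transitivity (\prod_(i < N.+1) (u + 1 * sX F D ^+ i) *
              \prod_(i < N.+1) (u + 1 * sX F D ^+ (N.+1 + i))).
  have -> : \prod_(i < N.+1) (u + 1 * sX F D ^+ i) =
      sX F (D * 'C(N.+1, 2)) * \prod_(i < N.+1) fac c^-1 (D - r + D * i)%N.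
    rewrite -sX_bin2 [X in _ * X](reindex_inj rev_ord_inj) -big_split.
    apply: eq_bigr => i _ /=.
    rewrite /u /fac sXX mul1r mulrDr mulr1 addrC mulrCA -sXD; congr (_ + _ * sX F _).
    have := ltn_ord i; nia.
  have -> : \prod_(i < N.+1) (u + 1 * sX F D ^+ (N.+1 + i)) =
      u ^+ N.+1 * \prod_(i < N.+1) fac c (r + D * i)%N.
    rewrite -[X in u ^+ X](card_ord N.+1) -prodr_const -big_split.
    apply: eq_bigr => i _ /=.
    rewrite /u /fac sXX mul1r mulrDr mulr1; congr (_ + _).
    rewrite mulrACA -rmorphM /= mulVf // rmorph1 mul1r -sXD; congr (sX F _); nia.
  by rewrite /u exprMn sXX rmorphXn sXD /=; ring.
rewrite {}h mulr_sumr; apply: eq_bigr => -[k lt_k] _ /=.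
rewrite expr1n mulr1 -mulrA [RHS]mulrCA; congr (_ * _).
rewrite /u exprMn !sXX [LHS]mulrCA -rmorphXn [RHS]mulrACA -rmorphM -!sXD /=.
congr (sC _ * sX F _).
  rewrite !exprVn !exprnN -expfzDr //; congr (c ^ _); lia.
suff : (D%:Z * 'C(k, 2)%:Z + (D%:Z - r%:Z + D%:Z * N%:Z) * ((N.+1 + N.+1)%N%:Z - k%:Z) =
   D%:Z * 'C(N.+1, 2)%:Z + (D%:Z - r%:Z + D%:Z * N%:Z) * N.+1%:Z + (texp D r (k%:Z - N.+1%:Z))%:Z).
  have : (k <= N.+1 + N.+1)%N by [].
  by nia.
have bk : 2 * ('C(k, 2))%:Z = k%:Z * k%:Z - k%:Z by have := double_bin2 k; lia.
have bN : 2 * ('C(N.+1, 2))%:Z = N.+1%:Z * N.+1%:Z - N.+1%:Z by have := double_bin2 N.+1; lia.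
have tE := texpE (k%:Z - N.+1%:Z) le_rD.
(* Doubling clears the binomial coefficients, leaving a polynomial identity. *)
apply: (@mulfI _ (2 : int)) => //; rewrite !mulrDr tE !(mulrCA 2) bk bN.
have -> : (N.+1 + N.+1)%N%:Z = (N%:Z + 1) + (N%:Z + 1) by lia.
have -> : N.+1%:Z = N%:Z + 1 by lia.
move: (k%:Z) (N%:Z) (D%:Z) (r%:Z) => k' N' D' r'; ring.
Qed.

(** Limit of the finite version: multiplied by f_D, the central Gaussian binomials tend to 1 and the
    outer terms have large exponents. *)
Lemma triple_product D r c : (0 < D)%N -> (r <= D)%N -> c != 0 ->
  is_theta D r c (qpoch c r D * qpoch c^-1 (D - r)%N D * ef F D).
Proof.
(* With N + 1 = 2 M + 2, an index j within M of either end has |j - (N + 1)| >= M + 2, so [texp_ge]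
   puts its exponent above M. *)
move=> D0 le_rD c0 M; pose N := (2 * M).+1.
pose shift k : int := k%:Z - N.+1%:Z.
exists [seq shift k | k <- iota 0 (N.+1 + N.+1).+1]; split=> [|n le_nM|k le_kM].
- by rewrite map_inj_uniq ?iota_uniq // => k k'; rewrite /shift; lia.
- apply/mapP; exists (absz (n + N.+1%:Z)); rewrite ?mem_iota /shift;
    have := texp_ge r n D0; lia.
rewrite big_map.
have qfact_ef m : (M < m)%N -> eqs M.+1 (qfact (sX F D) m) (ef F D).
  move=> lt_Mm; apply: eqs_leq (lt_Mm) _; apply/eqs_sym.
  have -> : qfact (sX F D) m = \prod_(i < m) fac (-1) (D + D * i)%N.
    by apply: eq_bigr => i _; rewrite sXX mulnS /fac rmorphN1 mulN1r.
  exact: (iprod_trunc (K := m) (adm_qpoch (-1) D D0)).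
have fg := ef_eg F D0.
(* The q-factorials of 2 (N + 1), j and 2 (N + 1) - j all agree with f_D up to degree M, so the
   binomial is f_D / f_D^2 there. *)
have qbin_inv j : (M < j)%N -> (M < (N.+1 + N.+1) - j)%N ->
    eqs M.+1 (qbin (sX F D) (N.+1 + N.+1) j * ef F D) 1.
  move=> lt_Mj lt_Mj'.
  have -> : qbin (sX F D) (N.+1 + N.+1) j * ef F D =
    qbin (sX F D) (N.+1 + N.+1) j * ef F D * ef F D * eg F D.
    by rewrite -[RHS]mulrA fg mulr1.
  rewrite -fg; apply: eqsM => //.
  have le_j : (j <= N.+1 + N.+1)%N by lia.
  apply: (@eqs_trans _ _ _ (qfact (sX F D) (N.+1 + N.+1))); last by apply: qfact_ef; lia.
  rewrite -(qbin_fact _ le_j); apply: eqsM; last exact/eqs_sym/qfact_ef.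
  by apply: eqsM => //; apply/eqs_sym/qfact_ef.
have prodE : eqs M.+1 (qpoch c r D * qpoch c^-1 (D - r) D * ef F D)
   (\sum_(k < (N.+1 + N.+1).+1) sC (c ^ shift k) * sX F (texp D r (shift k))).
  apply: (@eqs_trans _ _ _ ((\prod_(i < N.+1) fac c^-1 (D - r + D * i)%N) *
      (\prod_(i < N.+1) fac c (r + D * i)%N) * ef F D)).
    apply: eqsM => //; rewrite mulrC; apply: eqsM;
    by apply: eqs_leq (iprod_trunc (K := N.+1) (adm_qpoch _ _ D0)); lia.
  rewrite finite_triple_product // mulr_suml => i lt_iM.
  rewrite !scoef_sum; apply: eq_bigr => -[j lt_j] _ /=; move: i lt_iM.
  rewrite -/(eqs _ _ _) mulrAC -[X in eqs _ _ X]mul1r.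
  case: (boolP ((M < j) && (M < (N.+1 + N.+1) - j)))%N => [/andP[lt_Mj lt_Mj']|far].
    by apply: eqsM => //; apply: qbin_inv.
  move=> i lt_iM.
  have far0 (v : series F) : (v * (sC (c ^ shift j) * sX F (texp D r (shift j)))) i = 0.
    rewrite mulrCA scoefCM [v * _]mulrC scoefXM ifT ?mulr0 //.
    have := texp_ge r (shift j) D0; move: far; rewrite /shift; lia.
  by rewrite !far0.
rewrite prodE // scoef_sum -(big_mkord xpredT (fun j => (sC (c ^ shift j) *
  sX F (texp D r (shift j))) k)) /index_iota subn0 [RHS]big_mkcond /=.
apply: eq_bigr => j _; rewrite scoefCM /sX eq_sym.
by case: eqP; rewrite ?mulr1 ?mulr0.
Qed.

(* The two summands parametrize the pairs (m, n) with m + n even and odd. *)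
Definition lattice_map (p : int * int + int * int) : int * int :=
  match p with
  | inl (i, j) => (i + j, i - j)
  | inr (i, j) => (i - j + 1, i + j)
  end.

Lemma lattice_map_bij : bijective lattice_map.
Proof.
exists (fun p : int * int => let: (m, n) := p in
  if (m + n == 2 * ((m + n) %/ 2)%Z) then inl (((m + n) %/ 2)%Z, ((m - n) %/ 2)%Z)
  else inr (((m + n - 1) %/ 2)%Z, ((n - m + 1) %/ 2)%Z)) => [[[i j]|[i j]]|[m n]] /=.
- have -> : (i + j + (i - j) == 2 * ((i + j + (i - j)) %/ 2)%Z) by lia.
  by congr (inl (_, _)); lia.
- have -> : (i - j + 1 + (i + j) == 2 * ((i - j + 1 + (i + j)) %/ 2)%Z) = false by lia.
  by congr (inr (_, _)); lia.
- by case: eqP => ? /=; congr (_, _); lia.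
Qed.

(** Both sides are formal sums over Z^2, matched by [lattice_map]. The bound 2 r <= D gives D + 2 r
    <= 2 D, as [texpE] requires for the last family. *)
Lemma thetaM D r c d u v u1 u2 v1 v2 : (2 * r <= D)%N -> c != 0 -> d != 0 ->
  is_theta D r c u -> is_theta D r d v ->
  is_theta (2 * D) (2 * r) (c * d) u1 -> is_theta (2 * D) D (c / d) u2 ->
  is_theta (2 * D) (D + 2 * r) (c * d) v1 -> is_theta (2 * D) 0 (d / c) v2 ->
  u * v = u1 * u2 + sC c * sX F r * (v1 * v2).
Proof.
move=> le_rD c0 d0 uT vT u1T u2T v1T v2T.
have := has_sumD (has_sumM u1T u2T) (has_sumZ c r (has_sumM v1T v2T)).
apply: has_sum_uniq; apply: has_sum_bij lattice_map_bij _ _ (has_sumM uT vT).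
  by move=> [[i j]|[i j]] /=; rewrite !expfzDr // !expfzMl !exprz_inv ?expr1z; ring.
have le1 : (r <= D)%N by lia.
have le2 : (2 * r <= 2 * D)%N by lia.
have le3 : (D <= 2 * D)%N by lia.
have le4 : (D + 2 * r <= 2 * D)%N by lia.
have two0 : 2 != 0 :> int by [].
by move=> [[i j]|[i j]] /=; apply/eqP; rewrite -eqz_nat; apply/eqP/(mulfI two0);
  rewrite !PoszD !mulrDr !texpE //; lia.
Qed.

End JacobiTripleProduct.

(** * Special theta series as eta quotients, and their bilinear relations *)

Section ThetaProducts.
Variable F : fieldType.
Local Notation ef := (ef F).
Local Notation eg := (eg F).

(** The exponent is j n^2: this is Ramanujan's phi(q^j). *)
Lemma theta1_half j : (0 < j)%N ->
  is_theta (2 * j) j (1 : F) (ef (2 * j)%N ^+ 5 * eg j ^+ 2 * eg (4 * j)%N ^+ 2).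
Proof.
move=> j0; have j20 : (0 < 2 * j)%N by rewrite muln_gt0.
have := triple_product j20 (_ : j <= 2 * j)%N (oner_neq0 F); rewrite invr1.
have -> : (2 * j - j = j)%N by lia.
rewrite qpoch1_odd // => h; move: (h ltac:(lia)); congr (is_theta _ _ _ _).
by ring.
Qed.

(** This is 2 psi(q^d): n and 1 - n give the same triangular exponent. *)
Lemma theta1_0 d : (0 < d)%N -> is_theta d 0 (1 : F) (2 * ef (2 * d)%N ^+ 2 * eg d).
Proof.
move=> d0; have := triple_product d0 (leq0n d) (oner_neq0 F).
rewrite invr1 subn0 qpoch0 // qpoch1_ef // rmorphD rmorph1.
have fg := ef_eg F d0; congr (is_theta _ _ _ _).
by ring: fg.
Qed.

Lemma theta1_full d : (0 < d)%N -> is_theta d d (1 : F) (2 * ef (2 * d)%N ^+ 2 * eg d).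
Proof.
move=> d0; have := triple_product d0 (leqnn d) (oner_neq0 F).
rewrite invr1 subnn qpoch0 // qpoch1_ef // rmorphD rmorph1.
have fg := ef_eg F d0; congr (is_theta _ _ _ _).
by ring: fg.
Qed.

Lemma thetaN1_2_1 : is_theta 2 1 (-1 : F) (ef 1 ^+ 2 * eg 2).
Proof.
have N1 : (-1 : F) != 0 by rewrite oppr_eq0 oner_neq0.
have := triple_product (isT : 0 < 2)%N (isT : 1 <= 2)%N N1; rewrite invrN1.
have -> : qpoch (-1 : F) 1 2 = ef 1 * eg 2 := qpochN1_odd F (isT : 0 < 1)%N.
have fg := ef_eg F (isT : 0 < 2)%N; congr (is_theta _ _ _ _).
by ring: fg.
Qed.

(** Euler's pentagonal number theorem: the exponent is n (3 n - 1) / 2. *)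
Lemma thetaN1_3_1 : is_theta 3 1 (-1 : F) (ef 1).
Proof.
have N1 : (-1 : F) != 0 by rewrite oppr_eq0 oner_neq0.
have := triple_product (isT : 0 < 3)%N (isT : 1 <= 3)%N N1; rewrite invrN1.
congr (is_theta _ _ _ _); exact: esym (qpoch_split3 (-1) 1 (isT : 0 < 1)%N).
Qed.

Lemma theta1_6_2 : is_theta 6 2 (1 : F) (ef 4 * ef 6 ^+ 2 * eg 2 * eg 12).
Proof.
have := triple_product (isT : 0 < 6)%N (isT : 2 <= 6)%N (oner_neq0 F); rewrite invr1.
congr (is_theta _ _ _ _).
have : qpoch 1 2 2 = qpoch 1 2 6 * qpoch 1 4 6 * qpoch 1 6 6 := qpoch_split3 (1 : F) 2 (isT : 0 < 2)%N.
have -> : qpoch (1 : F) 2 2 = ef 4 * eg 2 := qpoch1_ef F (isT : 0 < 2)%N.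
have -> : qpoch (1 : F) 6 6 = ef 12 * eg 6 := qpoch1_ef F (isT : 0 < 6)%N.
have h6 : ef 6 * eg 6 = 1 := ef_eg F (isT : 0 < 6)%N.
have h12 : ef 12 * eg 12 = 1 := ef_eg F (isT : 0 < 12)%N.
move=> h; transitivity (ef 4 * eg 2 * (ef 6 ^+ 2 * eg 12)); last by ring.
by rewrite h -[(6 - 2)%N]/4%N; ring: h6 h12.
Qed.

Lemma theta1_6_5 :
  is_theta 6 5 (1 : F) (ef 2 ^+ 2 * ef 3 * ef 12 * eg 1 * eg 4 * eg 6).
Proof.
have := triple_product (isT : 0 < 6)%N (isT : 5 <= 6)%N (oner_neq0 F); rewrite invr1.
congr (is_theta _ _ _ _).
have : qpoch 1 1 2 = qpoch 1 1 6 * qpoch 1 3 6 * qpoch 1 5 6 := qpoch_split3 (1 : F) 1 (isT : 0 < 2)%N.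
have -> : qpoch (1 : F) 1 2 = ef 2 ^+ 2 * eg 1 * eg 4 := qpoch1_odd F (isT : 0 < 1)%N.
have -> : qpoch (1 : F) 3 6 = ef 6 ^+ 2 * eg 3 * eg 12 := qpoch1_odd F (isT : 0 < 3)%N.
have h3 : ef 3 * eg 3 = 1 := ef_eg F (isT : 0 < 3)%N.
have h6 : ef 6 * eg 6 = 1 := ef_eg F (isT : 0 < 6)%N.
have h12 : ef 12 * eg 12 = 1 := ef_eg F (isT : 0 < 12)%N.
move=> h; transitivity (ef 2 ^+ 2 * eg 1 * eg 4 * (ef 3 * ef 12 * eg 6)); last by ring.
by rewrite h -[(6 - 5)%N]/1%N; ring: h3 h6 h12.
Qed.

(** In classical terms, phi(-q)^2 = phi(q^2)^2 - 4 q psi(q^4)^2. *)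
Lemma theta_square :
  (ef 1 ^+ 2 * eg 2) ^+ 2 =
  (ef 4 ^+ 5 * eg 2 ^+ 2 * eg 8 ^+ 2) ^+ 2 - sX F 1 * (2 * ef 8 ^+ 2 * eg 4) ^+ 2.
Proof.
have N1 : (-1 : F) != 0 by rewrite oppr_eq0 oner_neq0.
have := @thetaM F 2 1 (-1) (-1) _ _ _ _ _ _ isT N1 N1 thetaN1_2_1 thetaN1_2_1.
rewrite invrN1 mulrNN mulr1 => /(_ _ _ _ _ (@theta1_half 2 isT) (@theta1_half 2 isT)).
move=> /(_ _ _ (@theta1_full 4 isT) (@theta1_0 4 isT)) h.
by rewrite expr2 h rmorphN1; ring.
Qed.

(** Not yet a 2-dissection, since f_3 / f_1 and f_3^(-2) remain on the right; [ef1_cube] removes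
    them. *)
Lemma ef1_square : ef 1 ^+ 2 =
  (ef 6 ^+ 5 * eg 3 ^+ 2 * eg 12 ^+ 2) * (ef 4 * ef 6 ^+ 2 * eg 2 * eg 12)
  - sX F 1 * (ef 2 ^+ 2 * ef 3 * ef 12 * eg 1 * eg 4 * eg 6) * (2 * ef 12 ^+ 2 * eg 6).
Proof.
have N1 : (-1 : F) != 0 by rewrite oppr_eq0 oner_neq0.
have := @thetaM F 3 1 (-1) (-1) _ _ _ _ _ _ isT N1 N1 thetaN1_3_1 thetaN1_3_1.
rewrite invrN1 mulrNN mulr1 => /(_ _ _ _ _ theta1_6_2 (@theta1_half 3 isT)).
move=> /(_ _ _ theta1_6_5 (@theta1_0 6 isT)) h.
by rewrite expr2 h rmorphN1; ring.
Qed.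

Section CubeRoot.
Variable w : F.
Hypothesis w3 : w ^+ 2 + w + 1 = 0.

Lemma cube_root_neq0 : w != 0.
Proof. by apply: contra_eq_neq w3 => ->; rewrite expr0n /= !add0r oner_neq0. Qed.

Lemma cube_root_inv : w^-1 = - w - 1.
Proof.
apply: (mulfI cube_root_neq0); rewrite divff ?cube_root_neq0 //.
by apply/eqP; rewrite -subr_eq0 -w3; apply/eqP; ring.
Qed.

Lemma cube_root_invP : w^-1 ^+ 2 + w^-1 + 1 = 0.
Proof. by rewrite cube_root_inv -[RHS]w3; ring. Qed.

(** Factor by factor, (1 + w y) (1 + y / w) (1 + y) = 1 + y^3. *)
Lemma qpoch_cube s r d : (0 < d)%N ->
  qpoch (s * w) r d * qpoch (s * w^-1) r d * qpoch s r d
  = qpoch (s ^+ 3) (3 * r)%N (3 * d)%N.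
Proof.
move=> d0; rewrite /qpoch -!iprodM; try by [apply: admM; exact: adm_qpoch | exact: adm_qpoch].
apply: eq_iprod => k; rewrite /fac.
have -> : (3 * r + 3 * d * k = (r + d * k) * 3)%N by ring.
rewrite -sXX rmorphXn !rmorphM /= cube_root_inv !rmorphB rmorphN rmorph1 /=.
have : sC w ^+ 2 + sC w + 1 = 0 by rewrite -rmorphXn -[1](rmorph1 (@sC F)) -!rmorphD /= w3 rmorph0.
move: (sC w) (sC s) (sX F _) => W S X WW.
have W2 : W ^+ 2 = - W - 1 by rewrite -[LHS]subr0 -WW; ring.
by ring: W2.
Qed.

Lemma theta_cube_1_0 : is_theta 1 0 (- w) (sC (1 - w) * ef 3).
Proof.
have w0 : - w != 0 by rewrite oppr_eq0 cube_root_neq0.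
have := triple_product (isT : 0 < 1)%N (isT : 0 <= 1)%N w0; congr (is_theta _ _ _ _).
rewrite qpoch0 // -!mulrA; congr (_ * _); rewrite mulrA.
have := qpoch_cube (-1) 1 (isT : 0 < 1)%N; rewrite !mulN1r -invrN => ->.
by rewrite -signr_odd.
Qed.

Lemma theta_cube_2_1 : is_theta 2 1 w (ef 6 ^+ 2 * ef 1 * ef 4 * eg 2 * eg 3 * eg 12).
Proof.
have := triple_product (isT : 0 < 2)%N (isT : 1 <= 2)%N cube_root_neq0; congr (is_theta _ _ _ _).
have := qpoch_cube 1 1 (isT : 0 < 2)%N; rewrite !mul1r expr1n.
have -> : qpoch (1 : F) 1 2 = ef 2 ^+ 2 * eg 1 * eg 4 := qpoch1_odd F (isT : 0 < 1)%N.
have -> : qpoch (1 : F) (3 * 1) (3 * 2) = ef 6 ^+ 2 * eg 3 * eg 12 := qpoch1_odd F (isT : 0 < 3)%N.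
have h1 : ef 1 * eg 1 = 1 := ef_eg F (isT : 0 < 1)%N.
have h2 : ef 2 * eg 2 = 1 := ef_eg F (isT : 0 < 2)%N.
have h4 : ef 4 * eg 4 = 1 := ef_eg F (isT : 0 < 4)%N.
move=> h; transitivity (ef 6 ^+ 2 * eg 3 * eg 12 * (ef 1 * ef 4 * eg 2)); last by ring.
by rewrite -h -[(2 - 1)%N]/1%N; ring: h1 h2 h4.
Qed.

Lemma theta_cube_2_0 :
  is_theta 2 0 w (sC (1 + w) * (ef 2 ^+ 2 * ef 12 * eg 4 * eg 6)).
Proof.
have := triple_product (isT : 0 < 2)%N (isT : 0 <= 2)%N cube_root_neq0; congr (is_theta _ _ _ _).
rewrite qpoch0 // -!mulrA; congr (_ * _).
have := qpoch_cube 1 2 (isT : 0 < 2)%N; rewrite !mul1r expr1n.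
have -> : qpoch (1 : F) 2 2 = ef 4 * eg 2 := qpoch1_ef F (isT : 0 < 2)%N.
have -> : qpoch (1 : F) (3 * 2) (3 * 2) = ef 12 * eg 6 := qpoch1_ef F (isT : 0 < 6)%N.
have h2 : ef 2 * eg 2 = 1 := ef_eg F (isT : 0 < 2)%N.
have h4 : ef 4 * eg 4 = 1 := ef_eg F (isT : 0 < 4)%N.
move=> h; transitivity (ef 12 * eg 6 * (ef 2 ^+ 2 * eg 4)); last by ring.
by rewrite -h subn0; ring: h2 h4.
Qed.

End CubeRoot.

(** Multiply T_(1,0)(-w) by T_(1,0)(-1/w). The left constants give (1 - w) (1 - 1/w) = 3; on the
    right the prefactor -w cancels the factor 1 + w, because -w (1 + w) = 1. *)
Lemma ef3_square (w : F) : w ^+ 2 + w + 1 = 0 ->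
  3 * ef 3 ^+ 2 =
  (2 * ef 4 ^+ 2 * eg 2) * (ef 6 ^+ 2 * ef 1 * ef 4 * eg 2 * eg 3 * eg 12) +
  (ef 2 ^+ 5 * eg 1 ^+ 2 * eg 4 ^+ 2) * (ef 2 ^+ 2 * ef 12 * eg 4 * eg 6).
Proof.
move=> w3; have w0 := cube_root_neq0 w3; have w3' := cube_root_invP w3.
have Nw : - w != 0 by rewrite oppr_eq0.
have Nw' : - w^-1 != 0 by rewrite oppr_eq0 invr_eq0.
have := @thetaM F 1 0 (- w) (- w^-1) _ _ _ _ _ _ isT Nw Nw'
  (theta_cube_1_0 w3) (theta_cube_1_0 w3').
have -> : - w * - w^-1 = 1 by rewrite mulrNN divff.
have ww : w * w = w^-1 by rewrite (cube_root_inv w3) -[LHS]subr0 -w3; ring.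
have -> : - w / - w^-1 = w^-1 by rewrite invrN invrK mulrNN.
have -> : - w^-1 / - w = w by rewrite invrN mulrNN -invfM ww invrK.
move=> /(_ _ _ _ _ (@theta1_0 2 isT) (theta_cube_2_1 w3')).
move=> /(_ _ _ (@theta1_half 1 isT) (theta_cube_2_0 w3)) h.
have e1 : sC (1 - w) * sC (1 - w^-1) = 3.
  rewrite -rmorphM /= -[RHS](rmorph_nat (@sC F) 3) (cube_root_inv w3).
  congr sC.
  by transitivity (3 - (w ^+ 2 + w + 1)); [ring | rewrite w3 subr0].
have e2 : sC (- w) * sC (1 + w) = 1.
  by rewrite -rmorphM -[RHS](rmorph1 (@sC F)); congr sC; rewrite -[RHS]subr0 -w3; ring.
move: h; rewrite sX0 mulr1 => h.
transitivity (sC (1 - w) * ef 3 * (sC (1 - w^-1) * ef 3)); first by rewrite -e1; ring.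
rewrite h; congr (_ + _).
by rewrite -[RHS]mul1r -e2; ring.
Qed.

End ThetaProducts.

(** * The two 2-dissections over the integers *)

Section Dissections.
Notation f := (ef int).
Notation g := (eg int).
Notation q := (sX int 1).

Lemma algC_cube_root : exists w : algC, w ^+ 2 + w + 1 = 0.
Proof.
have [w w_prim] := C_prim_root_exists (isT : 0 < 3)%N.
exists w; apply: (@mulfI _ (w - 1)); last first.
  rewrite mulr0; transitivity (w ^+ 3 - 1); first by ring.
  by rewrite (prim_expr_order w_prim) subrr.
by rewrite subr_eq0 -(expr1 w) -(prim_order_dvd w_prim).
Qed.

(** The theta identities hold over fields, one of them only with a cube root of unity; integer
    series inherit them from [algC] along this injection. *)
Let smap_algC_inj : injective (smap (intmul (1 : algC))).
Proof. by apply: smap_inj; apply: intr_inj. Qed.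

Lemma ef1_fourth :
  f 1 ^+ 4 = f 4 ^+ 10 * g 2 ^+ 2 * g 8 ^+ 4 - q * (4 * f 2 ^+ 2 * f 8 ^+ 4 * g 4 ^+ 2).
Proof.
have : (f 1 ^+ 2 * g 2) ^+ 2 =
    (f 4 ^+ 5 * g 2 ^+ 2 * g 8 ^+ 2) ^+ 2 - q * (2 * f 8 ^+ 2 * g 4) ^+ 2.
  apply: smap_algC_inj; move: (theta_square algC).
  by rewrite !(rmorphB, rmorphM, rmorphXn, rmorph_nat) /= !smap_ef ?smap_eg ?smap_sX.
have h2 : f 2 * g 2 = 1 := ef_eg int (isT : 0 < 2)%N.
move=> h; transitivity (f 2 ^+ 2 * (f 1 ^+ 2 * g 2) ^+ 2); first by ring: h2.
by rewrite h; ring: h2.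
Qed.


(* Let b(q) = f_1^3 / f_3 and let W be the odd part of the right-hand side, up
   to the factor -3q. Then ef1_square says b(q) = T(q) - 2 q W for an eta
   quotient T, and ef3_square says 3 T(-q) = 2 b(q^4) + b(-q); eliminating T
   gives b(q) = b(q^4) - 3 q W. *)
Lemma ef1_cube : f 1 ^+ 3 * g 3 =
  f 4 ^+ 3 * g 12 - q * (3 * f 2 ^+ 2 * f 12 ^+ 3 * g 4 * g 6 ^+ 2).
Proof.
have h1 : f 1 * g 1 = 1 := ef_eg int (isT : 0 < 1)%N.
have h2 : f 2 * g 2 = 1 := ef_eg int (isT : 0 < 2)%N.
have h3 : f 3 * g 3 = 1 := ef_eg int (isT : 0 < 3)%N.
have h4 : f 4 * g 4 = 1 := ef_eg int (isT : 0 < 4)%N.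
have h6 : f 6 * g 6 = 1 := ef_eg int (isT : 0 < 6)%N.
have h12 : f 12 * g 12 = 1 := ef_eg int (isT : 0 < 12)%N.
set b := LHS; set C := f 4 ^+ 3 * g 12.
pose W := f 2 ^+ 2 * f 12 ^+ 3 * g 4 * g 6 ^+ 2.
pose T := f 1 * g 3 ^+ 3 * f 6 ^+ 7 * f 4 * g 2 * g 12 ^+ 3.
have bE : b = T - 2 * q * W.
  have sq : f 1 ^+ 2 =
      (f 6 ^+ 5 * g 3 ^+ 2 * g 12 ^+ 2) * (f 4 * f 6 ^+ 2 * g 2 * g 12)
      - q * (f 2 ^+ 2 * f 3 * f 12 * g 1 * g 4 * g 6) * (2 * f 12 ^+ 2 * g 6).
    apply: smap_algC_inj; move: (ef1_square algC).
    by rewrite !(rmorphB, rmorphM, rmorphXn, rmorph_nat) /= !smap_ef ?smap_eg ?smap_sX.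
  by rewrite /b exprS sq /T /W; ring: h1 h3.
have altf1 : alt (f 1) = f 2 ^+ 3 * g 1 * g 4 := alt_ef_odd int (isT : odd 1).
have altf3 : alt (f 3) = f 6 ^+ 3 * g 3 * g 12 := alt_ef_odd int (isT : odd 3).
have altg3 : alt (g 3) = f 3 * f 12 * g 6 ^+ 3 := alt_eg_odd int (isT : odd 3).
have altf2 : alt (f 2) = f 2 := alt_ef_even int (isT : 0 < 1)%N.
have altf4 : alt (f 4) = f 4 := alt_ef_even int (isT : 0 < 2)%N.
have altf6 : alt (f 6) = f 6 := alt_ef_even int (isT : 0 < 3)%N.
have altf12 : alt (f 12) = f 12 := alt_ef_even int (isT : 0 < 6)%N.
have altg2 : alt (g 2) = g 2 := alt_eg_even int (isT : 0 < 1)%N.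
have altg4 : alt (g 4) = g 4 := alt_eg_even int (isT : 0 < 2)%N.
have altg6 : alt (g 6) = g 6 := alt_eg_even int (isT : 0 < 3)%N.
have altg12 : alt (g 12) = g 12 := alt_eg_even int (isT : 0 < 6)%N.
have altq : alt q = - q by apply/funext => -[|[|n]]; rewrite /alt /sX ?mulr0.
have altW : alt W = W.
  by rewrite /W !(rmorphM, rmorphXn) /= altf2 altf12 altg4 altg6.
have altC : alt C = C by rewrite /C !(rmorphM, rmorphXn) /= altf4 altg12.
have altT : alt T = f 2 ^+ 2 * g 1 * f 3 ^+ 3 * g 6 ^+ 2.
  rewrite /T !(rmorphM, rmorphXn) /= altf1 altg3 altf6 altf4 altg2 altg12.
  by ring: h2 h4 h6 h12.
have altb : alt b = (f 2 ^+ 3 * g 1 * g 4) ^+ 3 * (f 3 * f 12 * g 6 ^+ 3).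
  by rewrite /b !(rmorphM, rmorphXn) /= altf1 altg3.
have TE : 3 * alt T = 2 * C + alt b.
  have [w w3] := algC_cube_root.
  have sq : 3 * f 3 ^+ 2 =
      (2 * f 4 ^+ 2 * g 2) * (f 6 ^+ 2 * f 1 * f 4 * g 2 * g 3 * g 12) +
      (f 2 ^+ 5 * g 1 ^+ 2 * g 4 ^+ 2) * (f 2 ^+ 2 * f 12 * g 4 * g 6).
    apply: smap_algC_inj; move: (ef3_square w3).
    by rewrite !(rmorphD, rmorphM, rmorphXn, rmorph_nat) /= !smap_ef ?smap_eg ?smap_sX.
  (* The multiplier f_3 f_2^2 / (f_1 f_6^2) turns f_3^2 into T(-q). *)
  transitivity (f 3 * g 1 * f 2 ^+ 2 * g 6 ^+ 2 * (3 * f 3 ^+ 2)); first by rewrite altT; ring.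
  by rewrite sq altb /C; ring: h1 h2 h3 h6.
rewrite -[RHS](_ : C - 3 * q * W = _); last by rewrite /C /W; ring.
clear altT altb; clearbody b C W T.
have altbE : alt b = alt T + 2 * q * W.
  by rewrite {1}bE rmorphB !rmorphM /= altW altq rmorph_nat; ring.
(* T is eliminated at the cost of a factor 2, which is then cancelled coefficientwise in the
   integers. *)
have two_alt_b : 2 * (alt b - (C + 3 * q * W)) = 0.
  transitivity (3 * (alt b - (alt T + 2 * q * W)) + (3 * alt T - (2 * C + alt b))); first by ring.
  by rewrite TE altbE !subrr mulr0 addr0.
have {two_alt_b} alt_b : alt b = C + 3 * q * W.
  apply/funext => n; move/(congr1 (fun u : series int => u n)): two_alt_b.
  rewrite mulr_natl mulr2n scoefD scoefB => /eqP; rewrite -mulr2n mulrn_eq0 /= subr_eq0.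
  by move/eqP.
(* A second q -> -q returns from b(-q) to b(q). *)
rewrite -[LHS]altK alt_b rmorphD !rmorphM /= altC altW altq rmorph_nat.
by ring.
Qed.

End Dissections.

(** * Positivity of the dissected parts and the sign patterns *)

Section Signs.
Notation f := (ef int).
Notation g := (eg int).
Notation q := (sX int 1).

(** The coefficient of q^(2m+1) is -c V_m, and V_m has the sign (-1)^m; m = 2n and m = 2n + 1 give
    the two odd classes. *)
Lemma dissection_signs (A U V : series int) (c : nat) : (0 < c)%N ->
  A = dil U - q * (c%:R * dil V) ->
  (forall n, 0 < U n) -> (forall n, 0 < alt V n) ->
  forall n, [/\ 0 < A (2 * n)%N, A (4 * n + 1)%N < 0 & 0 < A (4 * n + 3)%N].
Proof.
move=> c0 AE U0 V0 n.
have coefA m : A m = if odd m then - (c%:R * V m./2) else U m./2.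
  rewrite AE -(rmorph_nat (@dil int) c) -rmorphM scoefB sX_dil /dil.
  by case: odd; rewrite ?sub0r ?subr0 // -(rmorph_nat (@sC int) c) scoefCM.
have V_sign m : V m = (-1) ^+ m * alt V m by rewrite -{1}(altK V).
rewrite !coefA !V_sign; have c0' : (0 : int) < c%:R by rewrite ltr0n.
have -> : (4 * n + 1)%N = (2 * n).*2.+1 by lia.
have -> : (4 * n + 3)%N = (2 * n).+1.*2.+1 by lia.
rewrite mul2n !oddS !odd_double /= !uphalf_double doubleK; split=> //.
  by rewrite -signr_odd odd_double expr0 mul1r oppr_lt0 mulr_gt0.
by rewrite -signr_odd /= odd_double expr1 mulN1r mulrN opprK mulr_gt0.
Qed.

(** Multiplication by such a series keeps every coefficient positive if all were positive before
    ([gt0_mul_unit]). *)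
Definition nonneg_unit (u : series int) := nonneg u /\ 0 < u 0%N.

Lemma nonneg_unitM u v : nonneg_unit u -> nonneg_unit v -> nonneg_unit (u * v).
Proof. by move=> [u0 u1] [v0 v1]; split; [exact: nonnegM | rewrite scoef0M mulr_gt0]. Qed.

Lemma nonneg_unitX u k : nonneg_unit u -> nonneg_unit (u ^+ k).
Proof.
move=> u1; elim: k => [|k IH]; last by rewrite exprS; apply: nonneg_unitM.
by split; [exact: nonneg1 | rewrite expr0 scoef1].
Qed.

Lemma nonneg_unit_eg j : (0 < j)%N -> nonneg_unit (g j).
Proof.
by move=> j0; split; [exact: nonneg_eg | have := eg_gt0 0 j0; rewrite muln0].
Qed.

Lemma nonneg_unit_qpoch1 r d : (0 < d)%N -> nonneg_unit (qpoch 1 r d).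
Proof. by move=> d0; split; [exact: nonneg_qpoch1 | exact: (@qpoch1_gt0 _ _ _ 0)]. Qed.

Lemma gt0_mul_unit (u v : series int) :
  (forall n, 0 < u n) -> nonneg_unit v -> forall n, 0 < (u * v) n.
Proof.
move=> u_gt0 [v0 v1] n; rewrite -[n]addn0.
by apply: scoefM_gt0 => // m; apply: ltW.
Qed.

(** f_2 / f_1 counts partitions into distinct parts, and n > 0 is one by itself; that part is the
    factor of index n - 1. *)
Lemma distinct_gt0 n : 0 < (f 2 * g 1) n.
Proof.
have <- : qpoch 1 1 1 = f 2 * g 1 := qpoch1_ef int (isT : 0 < 1)%N.
by apply: (@qpoch1_gt0 _ _ _ n.-1) => //; lia.
Qed.

Notation p := (qpoch (1 : int) 1 2).
Notation e := (qpoch (1 : int) 2 2).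

(** [p] counts partitions into distinct odd parts: the empty one and the single parts 1 and 3.
    Degree 2 has none. *)
Lemma p_gt0 i : i \in [:: 0; 1; 3]%N -> 0 < p i.
Proof.
by rewrite !inE => i013; apply: (@qpoch1_gt0 _ _ _ i./2) => //; case/or3P: i013 => /eqP ->.
Qed.

Lemma e_gt0 n : 0 < e (2 * n)%N.
Proof. by apply: (@qpoch1_gt0 _ _ _ n.-1) => //; lia. Qed.

Lemma pE : p = f 2 ^+ 2 * g 1 * g 4.
Proof. exact: (qpoch1_odd int (isT : 0 < 1)%N). Qed.

Lemma eE : e = f 4 * g 2.
Proof. exact: (qpoch1_ef int (isT : 0 < 2)%N). Qed.

Lemma nonneg_p : nonneg p. Proof. exact: nonneg_qpoch1. Qed.
Lemma nonneg_e : nonneg e. Proof. exact: nonneg_qpoch1. Qed.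

Lemma pe_gt0 n : 0 < (p * e) n.
Proof.
rewrite -(odd_double_half n) -mul2n; apply: scoefM_gt0 (e_gt0 _).
- exact: nonneg_p.
- exact: nonneg_e.
- by apply: p_gt0; case: odd.
Qed.

Notation phi := (f 2 ^+ 5 * g 1 ^+ 2 * g 4 ^+ 2).

(** The coefficient of q^k counts the integers n with n^2 = k. *)
Lemma phi_ge0 : nonneg phi /\ (0 < phi 0%N /\ 0 < phi 1%N).
Proof.
have phi_sum : is_theta 2 1 (1 : algC) (smap (intmul 1) phi).
  have := @theta1_half algC 1 isT.
  by rewrite !(rmorphM, rmorphXn) /= !smap_ef ?smap_eg.
have phi_gt0 k n : texp 2 1 n = k -> 0 < phi k.
  move=> nk; rewrite -(ltr0z algC) -[X in _ < X]/(smap (intmul 1) phi k).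
  have [r [r_uniq rP ->]] := phi_sum k; last by [].
  rewrite -big_filter (bigD1_seq n) /= ?filter_uniq ?mem_filter ?nk ?eqxx ?rP ?nk //.
  by rewrite ltr_pwDl ?exp1rz // sumr_ge0 // => i _; rewrite exp1rz.
split; last by split; [apply: (phi_gt0 0%N 0) | apply: (phi_gt0 1%N 1)].
move=> k; rewrite -(ler0z algC) -[X in _ <= X]/(smap (intmul 1) phi k).
have [r [_ _ ->]] := phi_sum k; last by [].
by rewrite sumr_ge0 // => i _; rewrite exp1rz.
Qed.

Lemma even2_gt0 n : 0 < (phi * p * g 4) n.
Proof.
have [phi0 [phi_0 phi_1]] := phi_ge0.
have n0 := nonnegM phi0 nonneg_p.
(* 1 / f_4 supplies the multiple of 4; the remainders 0, 1, 2, 3 arise as 0 + 0, 1 + 0, 1 + 1, 0 + 3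
   from the other two factors. *)
rewrite (divn_eq n 4) mulnC addnC; apply: (scoefM_gt0 n0 (@nonneg_eg 4)); last exact: eg_gt0.
have pp i : i \in [:: 0; 1; 3]%N -> 0 < p i := @p_gt0 i.
have := ltn_pmod n (isT : 0 < 4)%N; case: (n %% 4)%N => [|[|[|[|]]]] // _.
- exact: (scoefM_gt0 (i := 0%N) (j := 0%N) phi0 nonneg_p phi_0 (pp 0%N isT)).
- exact: (scoefM_gt0 (i := 1%N) (j := 0%N) phi0 nonneg_p phi_1 (pp 0%N isT)).
- exact: (scoefM_gt0 (i := 1%N) (j := 1%N) phi0 nonneg_p phi_1 (pp 1%N isT)).
- exact: (scoefM_gt0 (i := 0%N) (j := 3%N) phi0 nonneg_p phi_0 (pp 3%N isT)).
Qed.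

Lemma even3_gt0 n : 0 < (p * p * g 4) n.
Proof.
have n0 := nonnegM nonneg_p nonneg_p.
rewrite (divn_eq n 4) mulnC addnC; apply: (scoefM_gt0 n0 (@nonneg_eg 4)); last exact: eg_gt0.
have pp i : i \in [:: 0; 1; 3]%N -> 0 < p i := @p_gt0 i.
have := ltn_pmod n (isT : 0 < 4)%N; case: (n %% 4)%N => [|[|[|[|]]]] // _.
- exact: (scoefM_gt0 (i := 0%N) (j := 0%N) nonneg_p nonneg_p (pp 0%N isT) (pp 0%N isT)).
- exact: (scoefM_gt0 (i := 1%N) (j := 0%N) nonneg_p nonneg_p (pp 1%N isT) (pp 0%N isT)).
- exact: (scoefM_gt0 (i := 1%N) (j := 1%N) nonneg_p nonneg_p (pp 1%N isT) (pp 1%N isT)).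
- exact: (scoefM_gt0 (i := 0%N) (j := 3%N) nonneg_p nonneg_p (pp 0%N isT) (pp 3%N isT)).
Qed.

Definition gpoch r d : series int := iprod (fun k => geom int (r + d * k)%N).

Lemma qpoch_gpoch r d : (0 < r)%N -> (0 < d)%N -> qpoch (-1) r d * gpoch r d = 1.
Proof.
move=> r0 d0; rewrite -iprodM; [|exact: adm_qpoch|by apply: adm_geom => k; nia].
by apply: iprod1 => k; rewrite fac_geom // addn_gt0 r0.
Qed.

Lemma odd1_gt0 n : 0 < (f 3 ^+ 2 * g 1 * g 6) n.
Proof.
have h1 : f 1 * g 1 = 1 := ef_eg int (isT : 0 < 1)%N.
have h3 : f 3 * g 3 = 1 := ef_eg int (isT : 0 < 3)%N.
have f36 : qpoch (-1 : int) 3 6 = f 3 * g 6 := qpochN1_odd int (isT : 0 < 3)%N.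
have f1 : f 1 = qpoch (-1) 1 3 * qpoch (-1) 2 3 * f 3 := qpoch_split3 (-1 : int) 1 (isT : 0 < 1)%N.
have g13 := qpoch_gpoch (isT : 0 < 1)%N (isT : 0 < 3)%N.
have g23 := qpoch_gpoch (isT : 0 < 2)%N (isT : 0 < 3)%N.
have f31 : f 3 * g 1 = gpoch 1 3 * gpoch 2 3.
  apply: (ef_mulI (isT : 0 < 1)%N); rewrite mulrCA h1 mulr1 f1.
  by ring: g13 g23.
have adm_geom3 r : adm (fun k => geom int (r + 3 * k)%N) by apply: adm_geom => k; nia.
have adm36 : adm (fun k => fac (-1 : int) (3 + 6 * k)%N) by exact: adm_qpoch.
have -> : f 3 ^+ 2 * g 1 * g 6 = iprod (fun k => fac (-1) (3 + 6 * k)%N *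
    geom int (1 + 3 * k)%N * geom int (2 + 3 * k)%N).
  rewrite iprodM //; last exact: admM.
  by rewrite iprodM // -/(qpoch _ _ _) -!/(gpoch _ _) f36 -[RHS]mulrA -f31; ring.
have termE k : fac (-1) (3 + 6 * k)%N * geom int (1 + 3 * k)%N * geom int (2 + 3 * k)%N
    = geom int (2 + 3 * k)%N + sX int (1 + 3 * k)%N * geom int (1 + 3 * k)%N.
  by rewrite -geom_pair //; congr (fac _ _ * _ * _); ring.
have term_ge0 k : nonneg (sX int (1 + 3 * k)%N * geom int (1 + 3 * k)%N).
  by move=> i; rewrite scoefXM; case: ifP => // _; apply: nonneg_geom.
(* The factor k = 0 is 1 / (1 - q^2) + q / (1 - q), all of whose coefficients are positive. *)
apply: (@iprod_gt0 _ 0) => [|k|k|].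
- by do 2?apply: admM.
- by move=> i; rewrite termE scoefD addr_ge0 ?nonneg_geom ?term_ge0.
- by rewrite termE scoefD ltr_pwDl ?term_ge0 // /geom dvdn0.
rewrite termE scoefD; case: n => [|n]; first by rewrite ltr_pwDl ?term_ge0 // /geom dvdn0.
by rewrite ltr_wpDl ?nonneg_geom // scoefXM /= subn1 /geom dvd1n.
Qed.

Lemma alt_f1 : alt (f 1) = f 2 ^+ 3 * g 1 * g 4.
Proof. exact: (alt_ef_odd int (isT : odd 1)). Qed.

Lemma alt_f4 : alt (f 4) = f 4. Proof. exact: (alt_ef_even int (isT : 0 < 2)%N). Qed.
Lemma alt_g2 : alt (g 2) = g 2. Proof. exact: (alt_eg_even int (isT : 0 < 1)%N). Qed.

Let h1 : f 1 * g 1 = 1 := ef_eg int (isT : 0 < 1)%N.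
Let h2 : f 2 * g 2 = 1 := ef_eg int (isT : 0 < 2)%N.
Let h4 : f 4 * g 4 = 1 := ef_eg int (isT : 0 < 4)%N.

Lemma signs1 n : let A := f 1 ^+ 3 * g 2 * g 3 * g 4 ^+ 2 in
  [/\ 0 < A (2 * n)%N, A (4 * n + 1)%N < 0 & 0 < A (4 * n + 3)%N].
Proof.
have h6 : f 6 * g 6 = 1 := ef_eg int (isT : 0 < 6)%N.
(* U and V come from [ef1_cube] times 1 / (f_2 f_4^2), a series in q^2, by replacing q^2 with q. *)
apply: (@dissection_signs _ (f 2 * g 1 * g 6) (f 1 * f 6 ^+ 3 * g 2 ^+ 3 * g 3 ^+ 2) 3) => //.
- rewrite !(rmorphM, rmorphXn) /= !dil_ef // !dil_eg //.
  transitivity (f 1 ^+ 3 * g 3 * (g 2 * g 4 ^+ 2)); first by ring.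
  by rewrite ef1_cube -!/(f _) -!/(g _); ring: h2 h4.
- by apply: gt0_mul_unit distinct_gt0 _; apply: nonneg_unit_eg.
have -> : alt (f 1 * f 6 ^+ 3 * g 2 ^+ 3 * g 3 ^+ 2) =
    f 3 ^+ 2 * g 1 * g 6 * ((f 12 * g 6) ^+ 2 * g 4).
  rewrite !(rmorphM, rmorphXn) /= alt_f1 alt_g2.
  have -> : alt (g 3) = f 3 * f 12 * g 6 ^+ 3 := alt_eg_odd int (isT : odd 3).
  have -> : alt (f 6) = f 6 := alt_ef_even int (isT : 0 < 3)%N.
  by ring: h2 h6.
apply: gt0_mul_unit odd1_gt0 _; apply: nonneg_unitM; last exact: nonneg_unit_eg.
have <- : qpoch 1 6 6 = f 12 * g 6 := qpoch1_ef int (isT : 0 < 6)%N.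
by apply/nonneg_unitX/nonneg_unit_qpoch1.
Qed.

Lemma signs2 n : let A := f 1 ^+ 4 * g 2 * g 4 ^+ 3 in
  [/\ 0 < A (2 * n)%N, A (4 * n + 1)%N < 0 & 0 < A (4 * n + 3)%N].
Proof.
(* Here and in the next two cases [ef1_fourth] is multiplied by the remaining series in q^2, and q^2
   is replaced by q. V(-q) is always [p * e], positive in every degree, times a nonnegative series
   with positive constant term. *)
apply: (@dissection_signs _ (f 2 ^+ 7 * g 1 ^+ 3 * g 4 ^+ 4) (f 1 * f 4 ^+ 4 * g 2 ^+ 5) 4) => // [|m|].
- rewrite !(rmorphM, rmorphXn) /= !dil_ef // !dil_eg //.
  by rewrite ef1_fourth -!/(f _) -!/(g _); ring: h2 h4.
- have -> : f 2 ^+ 7 * g 1 ^+ 3 * g 4 ^+ 4 = phi * p * g 4 by rewrite pE; ring.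
  exact: even2_gt0.
have -> : alt (f 1 * f 4 ^+ 4 * g 2 ^+ 5) = p * e * e ^+ 3.
  by rewrite !(rmorphM, rmorphXn) /= alt_f1 alt_f4 alt_g2 pE eE; ring: h2.
by apply: gt0_mul_unit pe_gt0 _; apply/nonneg_unitX/nonneg_unit_qpoch1.
Qed.

Lemma signs3 n : let A := f 1 ^+ 4 * g 4 ^+ 6 in
  [/\ 0 < A (2 * n)%N, A (4 * n + 1)%N < 0 & 0 < A (4 * n + 3)%N].
Proof.
apply: (@dissection_signs _ (f 2 ^+ 4 * g 1 ^+ 2 * g 4 ^+ 4) (f 1 ^+ 2 * f 4 ^+ 4 * g 2 ^+ 8) 4) => //.
- rewrite !(rmorphM, rmorphXn) /= !dil_ef // !dil_eg //.
  by rewrite ef1_fourth -!/(f _) -!/(g _); ring: h2 h4.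
- have -> : f 2 ^+ 4 * g 1 ^+ 2 * g 4 ^+ 4 = p * p * g 4 * g 4 by rewrite pE; ring.
  by apply: gt0_mul_unit even3_gt0 _; apply: nonneg_unit_eg.
have -> : alt (f 1 ^+ 2 * f 4 ^+ 4 * g 2 ^+ 8) = p * e * (p * e ^+ 3 * g 2 ^+ 2).
  by rewrite !(rmorphM, rmorphXn) /= alt_f1 alt_f4 alt_g2 pE eE; ring: h2.
apply: gt0_mul_unit pe_gt0 _; do ?apply: nonneg_unitM;
  by do ?[apply: nonneg_unitX]; do ?[exact: nonneg_unit_eg | exact: nonneg_unit_qpoch1].
Qed.

Lemma signs4 n : let A := f 1 ^+ 4 * f 2 * g 4 ^+ 9 in
  [/\ 0 < A (2 * n)%N, A (4 * n + 1)%N < 0 & 0 < A (4 * n + 3)%N].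
Proof.
apply: (@dissection_signs _ (f 2 * g 1 * g 4 ^+ 4) (f 1 ^+ 3 * f 4 ^+ 4 * g 2 ^+ 11) 4) => //.
- rewrite !(rmorphM, rmorphXn) /= !dil_ef // !dil_eg //.
  by rewrite ef1_fourth -!/(f _) -!/(g _); ring: h2 h4.
- by apply: gt0_mul_unit distinct_gt0 _; apply/nonneg_unitX/nonneg_unit_eg.
have -> : alt (f 1 ^+ 3 * f 4 ^+ 4 * g 2 ^+ 11) = p * e * (p ^+ 2 * e ^+ 3 * g 2 ^+ 4).
  by rewrite !(rmorphM, rmorphXn) /= alt_f1 alt_f4 alt_g2 pE eE; ring: h2.
apply: gt0_mul_unit pe_gt0 _; do ?apply: nonneg_unitM;
  by do ?[apply: nonneg_unitX]; do ?[exact: nonneg_unit_eg | exact: nonneg_unit_qpoch1].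
Qed.

End Signs.

Theorem theorem4p8 (t1 t2 t3 t4 : int) (ht : (t1, t2, t3, t4) \in S7) (n : nat) :
  [/\ 0 < eta_quotient [:: t1; t2; t3; t4] (2 * n)%N,
      eta_quotient [:: t1; t2; t3; t4] (4 * n + 1)%N < 0
    & 0 < eta_quotient [:: t1; t2; t3; t4] (4 * n + 3)%N].
Proof.
rewrite eta_quotientE; move: ht; rewrite !inE => /or4P[] /eqP[-> -> -> ->] /=;
  rewrite ?expr0 ?expr1 ?mulr1; [exact: signs1 | exact: signs2 | exact: signs3 | exact: signs4].
Qed.
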